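(* Let $\Omega\subset\mathbb R^n$ be open, and let $0<d<n$, $1\le b<\infty$ and $a>0$ satisfy $\bigl(1-\frac{n-d}{b}\bigr)a\ge n-d$. Let $g\in W^{1,b}(\Omega)$ with $|g|^{-a}\in L^1(\Omega)$. Then $\mathcal H^d(\{x\in\Omega:g(x)=0\})=0$. *)

(* Defs.v *)
From HB Require Import structures.
From mathcomp Require Import all_boot all_order all_algebra.
From mathcomp Require Import all_classical all_reals all_analysis.
Set Implicit Arguments. Unset Strict Implicit. Unset Printing Implicit Defensive.
Import Order.TTheory GRing.Theory Num.Theory.
Import numFieldNormedType.Exports.
Local Open Scope classical_set_scope.
Local Open Scope ring_scope.

Section Defs.
Variables (R : realType) (n : nat).
Local Notation V := 'rV[R]_n.

Definition enorm (x : V) : R := Num.sqrt (\sum_(i < n) x ord0 i ^+ 2).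
Definition eball (x : V) (r : R) : set V := [set y | enorm (y - x) < r].

Definition box (a b : V) : set V :=
  [set x | forall i, a ord0 i <= x ord0 i <= b ord0 i].
Definition boxvol (a b : V) : R :=
  \prod_(i < n) Num.max (b ord0 i - a ord0 i) 0.

Definition leb (A : set V) : \bar R :=
  ereal_inf [set s | exists a b : nat -> V,
     A `<=` \bigcup_k box (a k) (b k) /\
     s = (\sum_(k <oo) (boxvol (a k) (b k))%:E)%E].

Definition leb_measurable (A : set V) : Prop :=
  forall B : set V, leb B = (leb (B `&` A) + leb (B `&` ~` A))%E.

Definition leb_measurable_fun (Om : set V) (f : V -> R) : Prop :=
  forall t : R, leb_measurable (Om `&` [set x | f x < t]).

(** Lebesgue integral over Om of a nonnegative extended-real function,
    via the layer-cake formula  int_Om F = int_0^oo leb(Om /\ {F > t}) dt  *)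
Definition lint (Om : set V) (F : V -> \bar R) : \bar R :=
  (\int[@lebesgue_measure R]_(t in [set t : R | (0 <= t)%R])
      leb (Om `&` [set x | (t%:E < F x)%E]))%E.

Definition sint (Om : set V) (f : V -> R) : \bar R :=
  (lint Om (fun x => (Num.max (f x) 0)%:E) -
   lint Om (fun x => (Num.max (- f x) 0)%:E))%E.

Definition Lp (p : R) (Om : set V) (f : V -> R) : Prop :=
  leb_measurable_fun Om f /\
  (lint Om (fun x => (`|f x| `^ p)%:E) < +oo)%E.

Definition unitv (i : 'I_n) : V := delta_mx ord0 i.
Definition partial (i : 'I_n) (f : V -> R) : V -> R :=
  fun x => 'D_(unitv i) f x.
Definition partials (s : seq 'I_n) (f : V -> R) : V -> R :=
  foldr partial f s.
Definition smooth (f : V -> R) : Prop :=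
  forall s : seq 'I_n, continuous (partials s f) /\
    (forall (i : 'I_n) (x : V), derivable (partials s f) x (unitv i)).

Definition test_fun (Om : set V) (phi : V -> R) : Prop :=
  smooth phi /\ compact (closure [set x | phi x != 0]) /\
  closure [set x | phi x != 0] `<=` Om.

Definition weak_partial (Om : set V) (i : 'I_n) (g h : V -> R) : Prop :=
  forall phi, test_fun Om phi ->
    sint Om (fun x => g x * partial i phi x) =
    (- sint Om (fun x => (h x * phi x)%R))%E.

Definition W1p (p : R) (Om : set V) (g : V -> R) : Prop :=
  Lp p Om g /\
  exists h : 'I_n -> V -> R,
    forall i, Lp p Om (h i) /\ weak_partial Om i g (h i).

Definition ball_avg (g : V -> R) (x : V) (r : R) : R :=
  fine (sint (eball x r) g) / fine (leb (eball x r)).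

(** zero set of (the precise representative of) g in Om:
    points x of Om at which the ball averages of g tend to 0 *)
Definition zero_set (Om : set V) (g : V -> R) : set V :=
  [set x | Om x /\ ball_avg g x r @[r --> 0^'+] --> (0 : R)].

(** d-dimensional Hausdorff measure on R^n (Euclidean distance), without
    the normalizing constant omega_d / 2^d *)
Definition diam (C : set V) : R :=
  sup [set enorm (x - y) | x in C & y in C].
Definition hausdorff_delta (d delta : R) (A : set V) : \bar R :=
  ereal_inf [set s | exists C : nat -> set V,
     A `<=` \bigcup_k C k /\
     (forall k x y, C k x -> C k y -> enorm (x - y) <= delta) /\
     s = (\sum_(k <oo) ((diam (C k)) `^ d)%:E)%E].
Definition hausdorff (d : R) (A : set V) : \bar R :=
  ereal_sup [set hausdorff_delta d delta A | delta in [set delta : R | 0 < delta]].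

End Defs.

(* Main.v *)
Require Import Defs.
From HB Require Import structures.
From mathcomp Require Import all_boot all_order all_algebra.
From mathcomp Require Import all_classical all_reals all_analysis.
From mathcomp Require Import measurable_realfun ring lra.

(** Let E = sum_j |D_j g|^b + |g|^-a. If x is a zero of g and the E-mass of every small cube of
    radius r around x is at most eps r^d, then Poincaré's inequality bounds the mean oscillation
    of g on these cubes by C eps^(1/b) r^gam with gam = 1 - (n-d)/b > 0, and since the averages
    of g at x tend to 0, telescoping over dyadic radii gives mean |g| <= C eps^(1/b) r^gam. Hence
    |g|^-a is at least a multiple of r^(-gam a) >= r^-(n-d) on half of the cube, and its mass is
    of order r^d: a contradiction for small eps. So every zero has arbitrarily small cubes of
    E-mass more than eps r^d, and a Vitali covering bounds the Hausdorff content of the zero set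
    by the E-mass of any neighbourhood of it. As d < n the zero set is Lebesgue null, so that
    absolute continuity of the integral makes this mass arbitrarily small.

    Poincaré's inequality is obtained by duality from test functions that are products of
    functions of one variable: averaging such a product in one coordinate at a time changes it by
    a partial derivative of another such product, to which the definition of the weak derivative
    applies. *)

Set Implicit Arguments. Unset Strict Implicit. Unset Printing Implicit Defensive.
Import Order.TTheory GRing.Theory Num.Theory.
Import numFieldNormedType.Exports.
Local Open Scope classical_set_scope.
Local Open Scope ring_scope.

(** * Lebesgue measure *)

Section boxes.
Context {R : realType} {n : nat}.
Local Notation V := 'rV[R]_n.+1.
Implicit Types a b x : V.

(** The exponent is forced by scaling. On a cube of radius r with E-mass at most eps r^d the average
    of |D_j g| is at most a constant times (eps r^(d-n))^(1/b), and Poincaré's inequality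
    contributes one factor r: this is eps^(1/b) r^gam. That gam is positive, so that the dyadic
    increments are summable, follows from gam a >= n - d > 0. The obstacle is that g is known only
    through an identity against test functions, whose smoothness speaks of all iterated partial
    derivatives. Test functions are therefore restricted to linear combinations of products, for
    which smoothness is a one-variable matter, and cubes rather than balls are the natural domains.
    Instead of mollifying g, the averaging acts on the test function, and the L1 norm of g - c is
    recovered by testing against approximate signs. These are built from the box covers in the
    definition of [leb]. Euclidean balls enter through [ball_avg] and are compared with cubes at the
    cost of dimensional constants. *)

Lemma boxvol_ge0 m (a b : 'rV[R]_m) : 0 <= boxvol a b.
Proof. by apply: prodr_ge0 => i _; rewrite le_max lexx orbT. Qed.

(** Having a coordinate [i] allows covers to be padded with boxes of volume 0. In dimension zero
    every box has volume 1 and even the empty set would have infinite measure, which is why the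
    dimension is written [n.+1]. *)
Lemma boxvol_eq0 a b i : b ord0 i <= a ord0 i -> boxvol a b = 0.
Proof.
move=> ba; rewrite /boxvol (bigD1 i)//= max_r ?mul0r//.
by rewrite subr_le0.
Qed.

Definition cover_box (A : set V) (c : nat -> V * V) :=
  A `<=` \bigcup_k box (c k).1 (c k).2.
Definition cover_sum (c : nat -> V * V) : \bar R :=
  (\sum_(k <oo) (boxvol (c k).1 (c k).2)%:E)%E.

Lemma leb_le A c : cover_box A c -> (leb A <= cover_sum c)%E.
Proof.
by move=> Ac; apply: ereal_inf_lbound; exists (fst \o c), (snd \o c).
Qed.

Lemma le_leb_inf (A : set V) (y : \bar R) :
  (forall c, cover_box A c -> (y <= cover_sum c)%E) -> (y <= leb A)%E.
Proof.
move=> h; apply: le_ereal_inf_tmp => _ [a [b [Aab ->]]].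
by apply: (h (fun k => (a k, b k))).
Qed.

Lemma leb_ge0 (A : set V) : (0 <= leb A)%E.
Proof.
by apply: le_leb_inf => c _; apply: nneseries_ge0 => k _ _; rewrite lee_fin boxvol_ge0.
Qed.

Lemma leb_adherent (A : set V) (e : R) : 0 < e -> (leb A < +oo)%E ->
  exists2 c, cover_box A c & (cover_sum c <= leb A + e%:E)%E.
Proof.
move=> e0 Afin.
have Af : leb A \is a fin_num by rewrite ge0_fin_numE// leb_ge0.
have [_ [a [b [Aab ->]]] /ltW H] := lb_ereal_inf_adherent e0 Af.
by exists (fun k => (a k, b k)).
Qed.

Lemma leb_box_le a b : (leb (box a b) <= (boxvol a b)%:E)%E.
Proof.
pose c k : V * V := if k == 0%N then (a, b) else (const_mx 1, const_mx 0).
have -> : (boxvol a b)%:E = cover_sum c.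
  rewrite /cover_sum (@nneseries_split _ _ 0%N 1%N)//; last first.
    by move=> k _; rewrite lee_fin boxvol_ge0.
  rewrite add0n big_nat1 eseries0 ?adde0//= => i i0 _.
  case: i i0 => // i _ /=; congr EFin.
  by apply: (@boxvol_eq0 _ _ ord0); rewrite !mxE ler01.
by apply: leb_le => x xab; exists 0%N.
Qed.

Lemma leb_set0 : leb (set0 : set V) = 0%E.
Proof.
apply/eqP; rewrite eq_le leb_ge0 andbT.
apply: (le_trans (leb_le (c := fun=> (const_mx 1, const_mx 0)) _)) => //=.
rewrite /cover_sum eseries0//= => i _ _; congr EFin.
by apply: (@boxvol_eq0 _ _ ord0); rewrite !mxE ler01.
Qed.

Lemma leb_mono : {homo (@leb R n.+1) : A B / A `<=` B >-> (A <= B)%E}.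
Proof.
by move=> A B AB; apply: le_leb_inf => c Bc; apply: leb_le; apply: subset_trans Bc.
Qed.

Lemma leb_sigma_subadditive : sigma_subadditive (@leb R n.+1).
Proof.
move=> A; have [[i ioo]|] := pselect (exists i, leb (A i) = +oo%E).
  rewrite (eseries_pinfty _ _ ioo) ?leey// => k _.
  by rewrite -ltNye (lt_le_trans _ (leb_ge0 _)).
rewrite -forallNE => Aoo.
apply/lee_addgt0Pr => _/posnumP[e].
rewrite (le_trans _ (epsilon_trick _ _ _))//; last by move=> k; exact: leb_ge0.
have [G PG] : {G : nat -> nat -> V * V & forall k, cover_box (A k) (G k) /\
    (cover_sum (G k) <= leb (A k) + (e%:num / (2 ^ k.+1)%:R)%:E)%E}.
  apply: (@choice _ _ (fun k c => cover_box (A k) c /\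
    (cover_sum c <= leb (A k) + (e%:num / (2 ^ k.+1)%:R)%:E)%E)) => k.
  have [|c c1 c2] := @leb_adherent (A k) (e%:num / (2 ^ k.+1)%:R) ltac:(by []).
    by rewrite ltey; apply/eqP; exact: Aoo.
  by exists c.
pose w (p : nat * nat) := (boxvol (G p.1 p.2).1 (G p.1 p.2).2)%:E.
have w0 p : (0 <= w p)%E by rewrite lee_fin boxvol_ge0.
(* The double family of boxes is enumerated by a bijection of the natural numbers with pairs; all
   terms being nonnegative, the sums may be rearranged. *)
have /card_esym/ppcard_eqP[f] := card_nat2.
apply: (@le_trans _ _ (\esum_(p in setT) w p)).
  apply: (le_trans (leb_le (c := fun k => G (f k).1 (f k).2) _)).
    move=> x [i _ /((PG i).1)[j _ xij]]; exists (f^-1%FUN (i, j)) => //=.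
    by rewrite invK ?inE.
  rewrite /cover_sum.
  rewrite -(esum_pred_image w _ xpredT) ?[fun=> _]set_true//.
  by rewrite image_eq.
have -> : (\esum_(p in setT) w p = \sum_(i <oo) cover_sum (G i))%E.
  rewrite nneseries_esumT; last first.
    by move=> i; apply: nneseries_ge0 => j _ _; exact: (w0 (i, j)).
  under [RHS]eq_esum => i _.
    rewrite /cover_sum nneseries_esumT//; last first.
      by move=> j; exact: (w0 (i, j)).
    over.
  rewrite (esum_esum (a := fun i j => w (i, j)))//.
  rewrite (_ : _ `*`` _ = setT); first by apply: eq_esum => -[].
  by apply/seteqP; split.
apply: lee_lim.
- by apply: is_cvg_nneseries => i *; apply: nneseries_ge0 => j *; exact: (w0 (i, j)).
- by apply: is_cvg_nneseries => i *; apply: adde_ge0 => //; exact: leb_ge0.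
- by near=> k; apply: lee_sum => i _; exact: (PG i).2.
Unshelve. all: by end_near. Qed.

End boxes.

HB.instance Definition _ (R : realType) (n : nat) :=
  isOuterMeasure.Build R 'rV[R]_n.+1 (@leb R n.+1)
    leb_set0 leb_ge0 leb_mono leb_sigma_subadditive.

(** Row vectors with the Carathéodory sigma-algebra of [leb]; its condition is the one in
    [leb_measurable], so the measurability assumed in the theorem is measurability for this
    structure. *)
Definition lebT (R : realType) (n : nat) := caratheodory_type (@leb R n.+1).
HB.instance Definition _ (R : realType) (n : nat) :=
  Measurable.copy (lebT R n) (caratheodory_type (@leb R n.+1)).
Definition lebm (R : realType) (n : nat) : set (lebT R n) -> \bar R := @leb R n.+1.
HB.instance Definition _ (R : realType) (n : nat) :=
  isMeasure.Build _ _ _ (@lebm R n) (@caratheodory_measure0 R _ (@leb R n.+1))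
   (@caratheodory_measure_ge0 R _ (@leb R n.+1))
   (@caratheodory_measure_sigma_additive R _ (@leb R n.+1)).

Section boxvol.
Context {R : realType} {n : nat}.
Local Notation V := 'rV[R]_n.+1.
Implicit Types a b : V.

Lemma integral_box_coord (p q K : R) : 0 <= K ->
  (\int[lebesgue_measure]_t (\1_(`[p, q]%classic) t * K)%:E =
   (Num.max (q - p) 0 * K)%:E)%E.
Proof.
move=> K0.
transitivity (\int[lebesgue_measure]_t ((\1_(`[p, q]%classic) t)%:E * K%:E))%E.
  by apply: eq_integral => t _; rewrite EFinM.
have mI : measurable_fun setT (fun t : R => (\1_(`[p, q]%classic) t : R)%:E).
  by apply/measurable_EFinP; exact: measurable_indic.
rewrite ge0_integralZr//=.
rewrite integral_indic// setIT EFinM; congr (_ * _)%E.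
rewrite [LHS]lebesgue_measure_itv/=.
rewrite lte_fin; case: ltP => pq.
  by rewrite max_l// subr_ge0 ltW.
by rewrite max_r// subr_le0.
Qed.

Lemma measurable_box_coord (p q K : R) :
  measurable_fun setT (fun t : R => (\1_(`[p, q]%classic) t * K : R)%:E).
Proof.
by apply/measurable_EFinP; apply: measurable_funM => //.
Qed.

(** The indicator of the box is at most the sum of the indicators of the covering boxes. Integrating
    in one coordinate at a time turns indicators into side lengths; monotone convergence, which
    exchanges sum and integral, takes the place of a compactness argument. *)
Lemma boxvol_le_cover a b c : cover_box (box a b) c ->
  ((boxvol a b)%:E <= cover_sum c)%E.
Proof.
move=> abc.
(* The [i]-th factor for the box [p] once the first [j] coordinates have been integrated out: a side
   length for [i < j], still an indicator otherwise. *)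
pose F (j : nat) (p : V * V) (x : 'I_n.+1 -> R) (i : 'I_n.+1) : R :=
  if (i < j)%N then Num.max (p.2 ord0 i - p.1 ord0 i) 0
  else \1_(`[p.1 ord0 i, p.2 ord0 i]%classic) (x i).
have F0 j p x i : 0 <= F j p x i.
  by rewrite /F; case: ifP => _; rewrite ?le_max ?lexx ?orbT// indicE.
suff H j : (j <= n.+1)%N -> forall x,
    ((\prod_i F j (a, b) x i)%:E <= \sum_(k <oo) (\prod_i F j (c k) x i)%:E)%E.
  have := H n.+1 (leqnn _) (fun=> 0); rewrite /F.
  under eq_bigr do rewrite ltn_ord.
  by under eq_eseriesr do under eq_bigr do rewrite ltn_ord.
elim: j => [_ x|j IH jn x].
  have S0 : (0 <= \sum_(k <oo) (\prod_i F 0 (c k) x i)%:E)%E.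
    by apply: nneseries_ge0 => k _ _; rewrite lee_fin prodr_ge0.
  have [xab|] := pselect (box a b (\row_i x i)); last first.
    move=> /existsNP[i]; rewrite mxE => /negP xi.
    by rewrite (bigD1 i)//= {1}/F/= indicE mem_setE in_itv/= (negbTE xi) mul0r.
  have [k _ xk] := abc _ xab.
  rewrite (nneseriesD1 (n := k))//; last by move=> i _; rewrite lee_fin prodr_ge0.
  rewrite -[leLHS]adde0; apply: leeD; last first.
    by apply: nneseries_ge0 => i _ _; rewrite lee_fin prodr_ge0.
  rewrite lee_fin; apply: (@le_trans _ _ 1).
    apply: prodr_ile1 => i _.
    by rewrite F0/= /F/= indicE lern1 leq_b1.
  rewrite big1// => i _; rewrite /F/= indicE mem_set//=.
  by have := xk i; rewrite mxE in_itv.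
have jn' : (j < n.+1)%N by [].
pose i0 := Ordinal jn'.
pose y t i := if i == i0 then t else x i.
pose K p := \prod_(i | i != i0) F j.+1 p x i.
have K0 p : 0 <= K p by apply: prodr_ge0.
have E1 p : \prod_i F j.+1 p x i = Num.max (p.2 ord0 i0 - p.1 ord0 i0) 0 * K p.
  by rewrite (bigD1 i0)//= {1}/F/= ltnSn.
have E2 p t : \prod_i F j p (y t) i =
    \1_(`[p.1 ord0 i0, p.2 ord0 i0]%classic) t * K p.
  rewrite (bigD1 i0)//= {1}/F/= ltnn /y eqxx; congr (_ * _).
  apply: eq_bigr => i ii0; rewrite /F (negbTE ii0) ltnS [(i <= j)%N]leq_eqVlt.
  suff -> : (nat_of_ord i == j) = false by [].
  by apply/negbTE; apply: contra ii0 => /eqP ij; apply/eqP/val_inj.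
rewrite E1 -integral_box_coord//.
under eq_eseriesr do rewrite E1 -integral_box_coord//.
rewrite -integral_nneseries//; last 2 first.
- by move=> k; exact: measurable_box_coord.
- by move=> k t _; rewrite lee_fin mulr_ge0// indicE.
apply: ge0_le_integral => //.
- by move=> t _; rewrite lee_fin mulr_ge0// indicE.
- exact: measurable_box_coord.
- apply: ge0_emeasurable_sum => //.
    by move=> k t _ _; rewrite lee_fin mulr_ge0// indicE.
  by move=> k _; exact: measurable_box_coord.
- move=> t _; have := IH (ltnW jn) (y t); rewrite E2.
  by under eq_eseriesr do rewrite E2.
Qed.

Lemma leb_box a b : leb (box a b) = (boxvol a b)%:E.
Proof.
apply/eqP; rewrite eq_le leb_box_le/=.
by apply: le_leb_inf => c; exact: boxvol_le_cover.
Qed.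
End boxvol.

Section lebesgue_sets.
Context {R : realType} {n : nat}.
Local Notation V := 'rV[R]_n.+1.
Local Notation T := (lebT R n).
Local Notation mu := (@lebm R n).
Implicit Types a b : V.

Lemma coord_le_norm (x : V) i : `|x ord0 i| <= `|x|.
Proof. by rewrite [leRHS]/Num.norm/= mx_normrE; exact: (le_bigmax _ _ (ord0, i)). Qed.

Definition setc (x : V) (i : 'I_n.+1) (t : R) : V :=
  \row_j (if j == i then t else x ord0 j).

(** When [t] lies outside the side, one of the two pieces is reversed and the maximum with 0 in
    [boxvol] discards it. *)
Lemma boxvol_split a b i t :
  boxvol a b = boxvol a (setc b i (Num.min (b ord0 i) t)) +
               boxvol (setc a i (Num.max (a ord0 i) t)) b.
Proof.
rewrite /boxvol !(bigD1 (P := xpredT) i)//= !mxE eqxx.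
have E (a' b' : V) : (forall j, j != i -> a' ord0 j = a ord0 j) ->
    (forall j, j != i -> b' ord0 j = b ord0 j) ->
  \prod_(j | j != i) Num.max (b' ord0 j - a' ord0 j) 0 =
  \prod_(j | j != i) Num.max (b ord0 j - a ord0 j) 0.
  by move=> ha hb; apply: eq_bigr => j ji; rewrite ha// hb.
rewrite !E//; try by move=> j ji; rewrite mxE (negbTE ji).
rewrite -mulrDl; congr (_ * _).
move: (a ord0 i) (b ord0 i) => p q.
by rewrite /Num.max /Num.min; do ![case: ifPn => //]; lra.
Qed.

(** Cutting every box of a cover along the hyperplane preserves the total volume, even with both
    halves closed. This is the Carathéodory inequality for half-spaces, from which boxes become
    measurable. *)
Lemma leb_split (X : set V) i t :
  (leb (X `&` [set x | (x ord0 i <= t)%R]) + leb (X `&` [set x | (t <= x ord0 i)%R])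
   <= leb X)%E.
Proof.
apply: le_leb_inf => c Xc.
pose c1 k := ((c k).1, setc (c k).2 i (Num.min ((c k).2 ord0 i) t)).
pose c2 k := (setc (c k).1 i (Num.max ((c k).1 ord0 i) t), (c k).2).
have -> : cover_sum c = (cover_sum c1 + cover_sum c2)%E.
  rewrite /cover_sum -nneseriesD//; try by move=> k _; rewrite lee_fin boxvol_ge0.
  by apply: eq_eseriesr => k _; rewrite (boxvol_split _ _ i t) EFinD.
apply: leeD; apply: leb_le => x [Xx /= xt].
- have [k _ xk] := Xc _ Xx; exists k => //= j; have /andP[h1 h2] := xk j.
  rewrite mxE h1/=; case: eqP => // ->; rewrite le_min xt andbT.
  by have /andP[] := xk i.
- have [k _ xk] := Xc _ Xx; exists k => //= j; have /andP[h1 h2] := xk j.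
  rewrite mxE h2/= andbT; case: eqP => // ->; rewrite ge_max xt andbT.
  by have /andP[] := xk i.
Qed.

Lemma measurable_halfspace i t : measurable ([set x : V | x ord0 i < t] : set T).
Proof.
apply: (@le_caratheodory_measurable R V (@leb R n.+1)) => X.
apply: le_trans (leb_split X i t); apply: leeD; apply: leb_mono => x [Xx /= h]; split => //=.
  exact: ltW.
by move/negP: h; rewrite -leNgt.
Qed.

Lemma measurable_coord i : measurable_fun setT (fun x : T => (x : V) ord0 i : R).
Proof.
apply: (measurability _ (RGenInftyO.measurableE R)) => //.
move=> /= _ [_ [t ->]] <-; rewrite setTI.
exact: (measurable_halfspace i t).
Qed.

Lemma measurable_forall (P : 'I_n.+1 -> set T) : (forall i, measurable (P i)) ->
  measurable [set x | forall i, P i x].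
Proof.
move=> mP; rewrite (_ : mkset _ = \bigcap_(i in [set: 'I_n.+1]) P i).
  by apply: fin_bigcap_measurable => // i _.
by apply/seteqP; split => x h i; [move=> _; exact: h|exact: (h i)].
Qed.

Definition obox (a b : V) : set V := [set x | forall i, a ord0 i < x ord0 i < b ord0 i].

Lemma measurable_coord_itv i (I : interval R) :
  measurable ([set x : V | x ord0 i \in I] : set T).
Proof.
have := measurable_coord i measurableT (measurable_itv I).
by rewrite setTI.
Qed.

Lemma measurable_obox a b : measurable (obox a b : set T).
Proof.
apply: measurable_forall => i.
exact: (measurable_coord_itv i `]a ord0 i, b ord0 i[%O).
Qed.

Lemma measurable_box a b : measurable (box a b : set T).
Proof.
apply: measurable_forall => i.
exact: (measurable_coord_itv i `[a ord0 i, b ord0 i]%O).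
Qed.

Lemma leb_face a b i : leb (box a b `&` [set x | x ord0 i = a ord0 i]) = 0%E.
Proof.
apply/eqP; rewrite eq_le leb_ge0 andbT.
apply: (@le_trans _ _ (leb (box a (setc b i (a ord0 i))))).
  apply: leb_mono => x [xab /= xi] j; rewrite mxE.
  by have /andP[h1 h2] := xab j; rewrite h1/=; case: eqP => // ->; rewrite xi.
by rewrite leb_box (@boxvol_eq0 _ _ _ _ i)// mxE eqxx.
Qed.

Lemma leb_face' a b i : leb (box a b `&` [set x | x ord0 i = b ord0 i]) = 0%E.
Proof.
apply/eqP; rewrite eq_le leb_ge0 andbT.
apply: (@le_trans _ _ (leb (box (setc a i (b ord0 i)) b))).
  apply: leb_mono => x [xab /= xi] j; rewrite mxE.
  by have /andP[h1 h2] := xab j; rewrite h2 andbT/=; case: eqP => // ->; rewrite xi.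
by rewrite leb_box (@boxvol_eq0 _ _ _ _ i)// mxE eqxx.
Qed.

Lemma leb_null_bigcup (F : nat -> set V) : (forall k, leb (F k) = 0%E) ->
  leb (\bigcup_k F k) = 0%E.
Proof.
move=> F0; apply/eqP; rewrite eq_le leb_ge0 andbT.
apply: (le_trans (leb_sigma_subadditive F)).
by rewrite eseries0.
Qed.

Lemma leb_box_obox a b : leb (box a b `\` obox a b) = 0%E.
Proof.
(* The faces are listed as a sequence, empty beyond the dimension, to fit countable
   subadditivity. *)
pose F k : set V := if insub k is Some i then
   (box a b `&` [set x | x ord0 i = a ord0 i]) `|` (box a b `&` [set x | x ord0 i = b ord0 i])
   else set0.
apply/eqP; rewrite eq_le leb_ge0 andbT -(@leb_null_bigcup F).
  apply: leb_mono => x [xab /existsNP[i xi]]; exists (val i) => //.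
  rewrite /F valK; have /andP[h1 h2] := xab i.
  move: xi; rewrite !lt_neqAle h1 h2 !andbT => /negP; rewrite negb_and !negbK.
  by case/orP => /eqP e; [left|right].
move=> k; rewrite /F; case: insub => [i|]; last exact: leb_set0.
apply/eqP; rewrite eq_le leb_ge0 andbT.
apply: (le_trans (outer_measureU2 (@leb R n.+1) _ _)).
by rewrite [X in (X + _)%E](leb_face a b i) [X in (_ + X)%E](leb_face' a b i) adde0.
Qed.

Lemma lebm_sigma_finite : sigma_finite setT mu.
Proof.
exists (fun k : nat => box (const_mx (- k%:R)) (const_mx k%:R) : set T).
  apply/seteqP; split => // x _.
  have [k hk] : exists k : nat, `|x : V| < k%:R by exists (Num.trunc `|x : V|).+1; exact: truncnS_gt.
  exists k => // i; rewrite !mxE -ler_norml (le_trans _ (ltW hk))//.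
  exact: coord_le_norm.
move=> k; split; first exact: measurable_box.
by rewrite /mu leb_box ltry.
Qed.

Lemma leb_translate (v : V) (A : set V) : leb [set x | A (x + v)] = leb A.
Proof.
have H w (B : set V) : (leb [set x | B (x + w)%R] <= leb B)%E.
  apply: le_leb_inf => c Bc.
  apply: (@le_trans _ _ (cover_sum (fun k => ((c k).1 - w, (c k).2 - w)))).
    apply: leb_le => x /= /Bc[k _ xk]; exists k => //= i.
    by have := xk i; rewrite !mxE lerBlDr lerBrDr.
  rewrite /cover_sum le_eqVlt; apply/orP; left; apply/eqP/eq_eseriesr => k _.
  by congr EFin; apply: eq_bigr => i _; rewrite !mxE opprB addrA subrK.
apply/eqP; rewrite eq_le H/=.
have := H (- v) [set x | A (x + v)]; congr (_ <= _)%E; congr leb.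
by apply/seteqP; split => x /=; rewrite subrK.
Qed.

End lebesgue_sets.

HB.instance Definition _ (R : realType) (n : nat) :=
  @Measure_isSigmaFinite.Build _ _ _ (@lebm R n) (@lebm_sigma_finite R n).

(** * Layer-cake integrals as Lebesgue integrals *)

Section layer_cake.
Context {R : realType} {n : nat}.
Local Notation V := 'rV[R]_n.+1.
Local Notation T := (lebT R n).
Local Notation mu := (@lebm R n).
Local Open Scope ereal_scope.

Lemma lebesgue_measure_subgraph (y : \bar R) : 0 <= y ->
  lebesgue_measure [set t : R | (0 <= t)%R && (t%:E < y)] = y.
Proof.
case: y => [r r0|_|//].
  have -> : [set t : R | (0 <= t)%R && (t%:E < r%:E)] = `[0%R, r[%classic.
    by apply/seteqP; split => t /=; rewrite in_itv/= lte_fin.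
  rewrite lebesgue_measure_itv/= lte_fin sube0.
  by case: ltP => // r0'; congr EFin; apply/eqP; rewrite eq_le r0' -lee_fin r0.
have -> : [set t : R | (0 <= t)%R && (t%:E < +oo)] = `[0%R, +oo[%classic.
  by apply/seteqP; split => t /=; rewrite in_itv/= ltry !andbT.
by rewrite lebesgue_measure_itv/= ltry.
Qed.

(** Tonelli's theorem for the region between 0 and the graph of [F]: its slice at height t has the
    measure that [lint] integrates, and its slice over x has length [F x]. *)
Lemma lint_integral (Om : set T) (F : T -> \bar R) : measurable Om ->
  measurable_fun Om F -> (forall x, Om x -> 0 <= F x) ->
  lint Om F = \int[mu]_(x in Om) F x.
Proof.
move=> mOm mF F0.
(* With [F] extended by 0, the strict superlevel sets at heights t >= 0 stay inside [Om]. *)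
pose F' := F \_ Om.
have mF' : measurable_fun setT F' by apply/(measurable_restrictT _ _).1.
have F'0 x : 0 <= F' x by rewrite /F' patchE; case: ifPn => // /set_mem/F0.
pose E : set (T * R) := [set p | (0 <= p.2)%R && (p.2%:E < F' p.1)].
have mE : measurable E.
  rewrite (_ : E = (setT `&` [set p | 0 <= (p.2)%:E]) `&`
     (setT `&` [set p : T * R | (p.2)%:E < F' p.1])); last first.
    rewrite !setTI; apply/seteqP; split => p /=.
      by rewrite /E/= lee_fin => /andP[].
    by rewrite /E/= lee_fin => -[-> ->].
  have m2 : measurable_fun setT (fun p : T * R => (p.2)%:E : \bar R).
    by apply/measurable_EFinP; exact: measurable_snd.
  apply: measurableI.
    by apply: emeasurable_fun_c_infty.
  apply: measurable_lte => //.
  by apply: measurableT_comp mF' _; exact: measurable_fst.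
rewrite integral_mkcond -/F'.
transitivity (\int[mu]_x fubini_F lebesgue_measure (EFin \o \1_E : T * R -> \bar R) x).
  rewrite (@indic_fubini_tonelli _ _ T _ R mu lebesgue_measure E mE).
  rewrite /lint integral_mkcond; apply: eq_integral => t _.
  rewrite /fubini_G/= patchE.
  transitivity (\int[mu]_x (\1_[set x | E (x, t)] x)%:E); last first.
    by apply: eq_integral => x _; rewrite !indicE.
  have mEt : measurable ([set x | E (x, t)] : set T).
    by have := measurable_ysection t mE; rewrite ysectionE.
  rewrite integral_indic// setIT; case: ifPn => [/set_mem/= t0|t0].
    congr leb; apply/seteqP; split => x; rewrite /E/= /F' patchE t0/=.
      by move=> [Omx xt]; rewrite mem_set.
    by case: ifPn => [/set_mem//|_]; rewrite lte_fin ltNge t0.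
  rewrite (_ : mkset _ = set0) ?measure0//; apply/seteqP; split => // x.
  by rewrite /E/= => /andP[t0' _]; move/negP: t0; apply; exact/mem_set.
apply: eq_integral => x _; rewrite /fubini_F/=.
rewrite -[RHS](lebesgue_measure_subgraph (F'0 x)).
transitivity (\int[lebesgue_measure]_t (\1_[set t | E (x, t)] t)%:E).
  by apply: eq_integral => t _; rewrite !indicE.
have mEx : measurable ([set t | E (x, t)] : set R).
  by have := measurable_xsection x mE; rewrite xsectionE.
by rewrite integral_indic// setIT.
Qed.

Lemma sint_integral (Om : set T) (f : T -> R) : measurable Om ->
  measurable_fun Om f -> sint Om f = \int[mu]_(x in Om) (f x)%:E.
Proof.
move=> mOm mf; rewrite integralE /sint; congr (_ - _).
  rewrite lint_integral//.
  - by apply: eq_integral => x _; rewrite funeposE -EFin_max.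
  - by apply/measurable_EFinP; apply: measurable_maxr.
  - by move=> x _; rewrite lee_fin le_max lexx orbT.
rewrite lint_integral//.
- by apply: eq_integral => x _; rewrite funenegE -EFinN -EFin_max.
- by apply/measurable_EFinP; apply: measurable_maxr => //; exact: measurable_funN.
- by move=> x _; rewrite lee_fin le_max lexx orbT.
Qed.

(** The set [Om] is itself measurable because it is the union of its sublevel sets at natural
    levels. *)
Lemma leb_measurable_fun_measurable (Om : set T) (f : T -> R) :
  leb_measurable_fun Om f -> measurable Om /\ measurable_fun Om f.
Proof.
move=> mf; split.
  rewrite (_ : Om = \bigcup_k (Om `&` [set x | f x < k%:R]%R)).
    by apply: bigcupT_measurable => k; exact: (mf k%:R%R).
  apply/seteqP; split => [x Omx|x [k _ []//]].
  by exists (Num.trunc (f x)).+1 => //; split => //=; exact: truncnS_gt.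
apply: (measurability _ (RGenInftyO.measurableE R)) => //.
by move=> /= _ [_ [t ->]] <-; exact: (mf t).
Qed.

End layer_cake.

(** * Smooth functions of one variable *)

Section smooth_line.
Context {R : realType}.
Implicit Types (u v : R -> R).

(* A coinductive notion of smoothness: u belongs to a class closed under differentiation. *)
Definition smooth1 u := exists2 C : set (R -> R), C u &
  forall v, C v -> exists2 v', C v' & forall x : R, is_derive x 1 v (v' x).

Lemma smooth1_deriv u : smooth1 u ->
  exists2 u', smooth1 u' & forall x : R, is_derive x 1 u (u' x).
Proof.
by move=> [C Cu HC]; have [u' Cu' du] := HC _ Cu; exists u' => //; exists C.
Qed.

Lemma smooth1_continuous u : smooth1 u -> continuous u.
Proof.
move=> /smooth1_deriv[u' _ du] x; apply/differentiable_continuous/derivable1_diffP.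
by have [] := du x.
Qed.

Inductive algebra_span (C : set (R -> R)) : (R -> R) -> Prop :=
| span_in u : C u -> algebra_span C u
| span_cst c : algebra_span C (cst c)
| span_add u v : algebra_span C u -> algebra_span C v -> algebra_span C (u \+ v)
| span_mul u v : algebra_span C u -> algebra_span C v -> algebra_span C (u \* v).

(** The product rule leads out of the class [C], so the class witnessing smoothness is the algebra
    it generates: the sum and product rules extend differentiability from generators to all of
    it. *)
Lemma smooth1_span (C : set (R -> R)) :
  (forall v, C v -> exists2 v', algebra_span C v' & forall x : R, is_derive x 1 v (v' x)) ->
  forall u, algebra_span C u -> smooth1 u.
Proof.
move=> HC u Cu; exists (algebra_span C) => // v; elim.
- by move=> {}v /HC.
- by move=> c; exists (cst 0); [exact: span_cst|move=> x; exact: is_derive_cst].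
- move=> v1 v2 _ [w1 C1 d1] _ [w2 C2 d2]; exists (w1 \+ w2); first exact: span_add.
  by move=> x; exact: is_deriveD.
- move=> v1 v2 Cv1 [w1 C1 d1] Cv2 [w2 C2 d2].
  exists ((v1 \* w2) \+ (v2 \* w1)); first by apply: span_add; exact: span_mul.
  by move=> x; exact: is_deriveM.
Qed.

Lemma smooth1_span2 u v w : smooth1 u -> smooth1 v ->
  algebra_span [set u; v] w -> smooth1 w.
Proof.
move=> [Cu Cuu Hu] [Cv Cvv Hv] Cw.
apply: (@smooth1_span (Cu `|` Cv)).
  move=> f [/Hu|/Hv] [f' Cf' df].
    by exists f' => //; apply: span_in; left.
  by exists f' => //; apply: span_in; right.
elim: Cw => [_ [->|->]|c|*|*].
- by apply: span_in; left.
- by apply: span_in; right.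
- exact: span_cst.
- exact: span_add.
- exact: span_mul.
Qed.

Lemma smooth1M u v : smooth1 u -> smooth1 v -> smooth1 (u \* v).
Proof.
move=> su sv; apply: (smooth1_span2 su sv).
by apply: span_mul; apply: span_in; [left|right].
Qed.

Lemma smooth1D u v : smooth1 u -> smooth1 v -> smooth1 (u \+ v).
Proof.
move=> su sv; apply: (smooth1_span2 su sv).
by apply: span_add; apply: span_in; [left|right].
Qed.

Lemma smooth1Z c u : smooth1 u -> smooth1 (fun x => c * u x).
Proof.
move=> su; apply: (smooth1_span2 su su (w := cst c \* u)).
by apply: span_mul; [exact: span_cst|apply: span_in; left].
Qed.

Lemma is_derive_affine u (u' c e x : R) : is_derive (c * x + e) 1 u u' ->
  is_derive x 1 (fun t => u (c * t + e)) (c * u').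
Proof.
move=> du; rewrite mulrC.
apply: (@is_derive1_comp _ u (fun t => c * t + e)) => //.
have := @is_deriveD _ _ _ (fun t => c * t) (cst e) x 1 c 0.
by rewrite addr0; apply; have := @is_deriveZ _ _ _ id c x 1 1 (is_derive_id _ _);
  rewrite /GRing.scale/= mulr1.
Qed.

Lemma smooth1_affine c e u : smooth1 u -> smooth1 (fun x => u (c * x + e)).
Proof.
move=> [C Cu HC].
pose C' : set (R -> R) := [set w | exists2 v, C v & w = fun x => v (c * x + e)].
apply: (@smooth1_span C'); last by apply: span_in; exists u.
move=> _ [v Cv ->]; have [v' Cv' dv] := HC _ Cv.
exists (cst c \* (fun x => v' (c * x + e))).
  by apply: span_mul; [exact: span_cst|apply: span_in; exists v'].
by move=> x; exact: is_derive_affine.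
Qed.

Lemma smooth1_primitive u U : smooth1 u -> (forall x : R, is_derive x 1 U (u x)) ->
  smooth1 U.
Proof.
move=> [C Cu HC] dU; exists (C `|` [set U]); first by right.
move=> v [/HC[v' Cv' dv]|->]; first by exists v' => //; left.
by exists u => //; left.
Qed.

(** The difference quotient at 0 is at most c |h|. This settles the origin, the one point where
    [expinv] is not locally given by a formula. *)
Lemma is_derive_quadratic (f : R -> R) (c : R) :
  (forall h, `|f h| <= c * h ^+ 2) -> is_derive (0 : R) 1 f 0.
Proof.
move=> fc.
have f0 : f 0 = 0 by apply/normr0_eq0/eqP; rewrite eq_le normr_ge0 andbT (le_trans (fc 0))// expr0n mulr0.
have H : h^-1 *: (f (h *: (1 : R) + 0) - f 0) @[h --> (0 : R)^'] --> (0 : R).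
  apply/cvgr0Pnorm_le => e e0.
  near=> h.
  have h0 : h != 0 by near: h; exact: nbhs_dnbhs_neq.
  rewrite addr0 f0 subr0 /GRing.scale/= mulr1 normrM normfV.
  rewrite ler_pdivrMl ?normr_gt0//.
  apply: (le_trans (fc h)).
  rewrite -[h ^+ 2]real_normK ?num_real// expr2 mulrCA ler_wpM2l//.
  have : `|h| <= e / (`|c| + 1).
    near: h; apply: dnbhs0_le; by rewrite divr_gt0// ltr_wpDl.
  rewrite ler_pdivlMr ?ltr_wpDl// mulrDr mulr1 mulrC => He.
  apply: le_trans He; rewrite (le_trans (ler_wpM2r _ (ler_norm c)))//.
  by rewrite lerDl.
apply: DeriveDef; first by apply/cvg_ex; exists 0.
by apply/cvg_lim.
Unshelve. all: by end_near. Qed.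

(** The functions x^-k exp(-1/x), extended by 0 to x <= 0. Differentiation stays inside the linear
    span of this family, so the whole family is treated at once. *)
Definition expinv (k : nat) (x : R) : R := if 0 < x then x^-1 ^+ k * expR (- x^-1) else 0.

Lemma expinv_ge0 k x : 0 <= expinv k x.
Proof.
by rewrite /expinv; case: ltP => // x0; rewrite mulr_ge0 ?expR_ge0// exprn_ge0// invr_ge0 ltW.
Qed.

(** With y = 1/x, the exponential series gives exp y >= y^(k+2) / (k+2)!, two powers more than the
    factor y^k consumes. *)
Lemma expinv_quadratic k x : `|expinv k x| <= (k.+2)`!%:R * x ^+ 2.
Proof.
rewrite ger0_norm ?expinv_ge0// /expinv; case: ltP => x0; last first.
  by rewrite mulr_ge0// sqr_ge0.
have xi : 0 < x^-1 by rewrite invr_gt0.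
rewrite expRN ler_pdivrMr ?expR_gt0//.
have := expR_ge1Dxn k.+1 (ltW xi).
set N := (k.+2)`!%:R => H.
have N0 : 0 < N by rewrite ltr0n fact_gt0.
apply: (@le_trans _ _ (N * x ^+ 2 * (x^-1 ^+ k.+2 / N))); last first.
  apply: ler_wpM2l; first by rewrite mulr_ge0 ?sqr_ge0// ltW.
  by apply: le_trans H; rewrite lerDr.
rewrite le_eqVlt; apply/orP; left; apply/eqP.
have xn0 : x != 0 by rewrite gt_eqF.
have Nn0 : N != 0 by rewrite gt_eqF.
rewrite -(addn2 k) exprD; move: (x^-1 ^+ k) => y; field.
by rewrite xn0 Nn0.
Qed.

Lemma is_derive_expinv k (x : R) :
  is_derive x 1 (expinv k) (expinv k.+2 x - k%:R * expinv k.+1 x).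
Proof.
have [x0|x0|->] := ltrgt0P x.
- apply: (@near_eq_is_derive R R^o R^o (fun y : R => y^-1 ^+ k * expR (- y^-1))).
  + near=> y; rewrite /expinv ifT//.
    by near: y; exact: lt_nbhsr.
  have xn0 : x != 0 by rewrite gt_eqF.
  have dV : is_derive x 1 (fun y : R => y^-1) (- x ^- 2).
    by have := @is_deriveV _ id x 1 1 xn0 (is_derive_id _ _); rewrite /GRing.scale/= mulr1.
  have dN : is_derive x 1 (fun y : R => - y^-1) (x ^- 2).
    by have := is_deriveN dV; rewrite opprK.
  have dE : is_derive x 1 (fun y : R => expR (- y^-1)) (expR (- x^-1) * x ^- 2).
    exact: (@is_derive1_comp _ expR (fun y : R => - y^-1)).
  have dX := @is_deriveX _ _ _ k x 1 _ dV.
  have := is_deriveM dX dE.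
  rewrite (_ : (fun y : R => y^-1) ^+ k * _ = (fun y => y^-1 ^+ k * expR (- y^-1))); last first.
    by apply/funext => y; rewrite fctE/= exprfctE.
  move/is_derive_eq; apply.
  rewrite /expinv x0 /GRing.scale/=.
  have -> : ((fun y : R => y^-1) ^+ k) x = x^-1 ^+ k by rewrite exprfctE.
  rewrite -exprVn; move: (expR (- x^-1)) (x^-1) => E z {dN dV dE dX x0 xn0}.
  case: k => [|k] /=; first by rewrite expr0 !(mul0r, mulr0, mul1r, oppr0, addr0) mulrC.
  by rewrite !exprS expr0; move: (z ^+ k) => w; ring.
- apply: (@near_eq_is_derive R R^o R^o (cst 0)).
  + near=> y; rewrite /expinv ifF//; apply/negbTE; rewrite -leNgt ltW//.
    by near: y; exact: lt_nbhsl.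
  by rewrite /expinv (lt_gtF x0) mulr0 subr0; exact: is_derive_cst.
- rewrite /expinv ltxx mulr0 subr0.
  exact: is_derive_quadratic (expinv_quadratic k).
Unshelve. all: by end_near. Qed.

Lemma smooth1_expinv : smooth1 (expinv 0).
Proof.
apply: (@smooth1_span [set u | exists k, u = expinv k]); last first.
  by apply: span_in; exists 0%N.
move=> _ [k ->]; exists (expinv k.+2 \+ (cst (- k%:R) \* expinv k.+1)).
  apply: span_add; first by apply: span_in; exists k.+2.
  by apply: span_mul; [exact: span_cst|apply: span_in; exists k.+1].
by move=> x; have := is_derive_expinv k x; rewrite /= mulNr.
Qed.

End smooth_line.

(** * Compactly supported functions and bumps on the line *)

Section smooth_supp.
Context {R : realType}.
Implicit Types (u v : R -> R) (a b : R).

Definition smooth_supp a b u := smooth1 u /\ forall x, ~~ (a < x < b) -> u x = 0.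

Lemma mvt_le (f f' : R -> R) (a x M : R) : a <= x ->
  (forall t : R, is_derive t 1 f (f' t)) ->
  (forall t, a < t < x -> `|f' t| <= M) -> `|f x - f a| <= M * (x - a).
Proof.
rewrite le_eqVlt => /predU1P[<- _ _|ax df f'M]; first by rewrite !subrr normr0 mulr0.
have cf : continuous f.
  move=> t; apply/differentiable_continuous/derivable1_diffP.
  by have [] := df t.
have [c] := MVT ax (fun t _ => df t) (continuous_subspaceT cf).
rewrite in_itv/= => cax ->.
have xa0 : 0 <= x - a by rewrite subr_ge0 ltW.
by rewrite normrM (ger0_norm xa0) ler_wpM2r// f'M.
Qed.

Lemma smooth_supp_bounded a b u : smooth_supp a b u ->
  exists2 M, 0 <= M & forall x, `|u x| <= M.
Proof.
move=> [su u0]; have [ab|ba] := leP a b; last first.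
  exists 0 => // x; rewrite u0 ?normr0//; apply/negP => /andP[ax xb].
  by have := lt_trans (lt_trans ax xb) ba; rewrite ltxx.
have cu : {within `[a, b], continuous (fun x => `|u x|)}.
  apply: continuous_subspaceT => x; apply: continuous_comp.
    exact: smooth1_continuous.
  exact: norm_continuous.
have [c cab H] := EVT_max ab cu.
exists `|u c| => // x; have [xab|xab] := boolP (a < x < b).
  by apply: H; rewrite in_itv/=; case/andP: xab => /ltW -> /ltW ->.
by rewrite u0// normr0.
Qed.

Lemma smooth_supp_integrable a b u : smooth_supp a b u ->
  (@lebesgue_measure R).-integrable setT (EFin \o u).
Proof.
move=> [su u0].
have iu : (@lebesgue_measure R).-integrable `[a, b] (EFin \o u).
  apply: continuous_compact_integrable; first exact: segment_compact.
  by apply: continuous_subspaceT; exact: smooth1_continuous.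
have : (@lebesgue_measure R).-integrable setT ((EFin \o u) \_ `[a, b]).
  by apply/integrable_restrict => //; rewrite setTI.
suff -> : (EFin \o u) \_ `[a, b] = EFin \o u by [].
apply/funext => x; rewrite patchE/=.
case: ifPn => // /negP xab; rewrite u0//; apply/negP => /andP[/ltW ax /ltW xb].
by apply: xab; rewrite mem_setE in_itv/= ax.
Qed.

(** The final value [U b], the integral of [u], is the obstruction to [U] being supported in the
    interval; [average_step] cancels it with a primitive of a bump of unit mass. *)
Lemma smooth_supp_primitive a b u : smooth_supp a b u -> a <= b ->
  exists U, [/\ forall x : R, is_derive x 1 U (u x),
    forall x, x <= a -> U x = 0 & forall x, b <= x -> U x = U b].
Proof.
move=> su ab; have [su1 u0] := su.
pose U x := (\int[@lebesgue_measure R]_(t in `]-oo, x]) u t)%R.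
have dU (x : R) : is_derive x 1 U (u x).
  have [||||dx xE] := @continuous_FTC1 R u -oo%O x (x + 1).
  - by rewrite ltrDl.
  - apply: integrableS (smooth_supp_integrable su) => //.
  - by rewrite ltNyr.
  - exact: smooth1_continuous.
  by rewrite -xE derive1E; apply: derivableP.
exists U; split => //.
  move=> x xa; rewrite /U (_ : Rintegral _ _ _ = Rintegral lebesgue_measure `]-oo, x] (cst 0)).
    by rewrite Rintegral_cst// mul0r.
  apply: eq_Rintegral => t; rewrite inE/= in_itv/= => tx.
  by rewrite u0// negb_and -leNgt (le_trans tx xa).
move=> x bx; apply/eqP; rewrite -subr_eq0 -normr_eq0 eq_le normr_ge0 andbT.
rewrite -[leRHS](mul0r (x - b)); apply: mvt_le => // t /andP[bt tx].
by rewrite u0 ?normr0// negb_and -(leNgt b t) (ltW bt) orbT.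
Qed.

Lemma smooth_suppM a b u v : smooth_supp a b u -> smooth1 v -> smooth_supp a b (u \* v).
Proof.
by move=> [su u0] sv; split => [|x xab]; [exact: smooth1M|rewrite /= u0// mul0r].
Qed.

Lemma smooth_suppZ a b c u : smooth_supp a b u -> smooth_supp a b (fun x => c * u x).
Proof.
by move=> [su u0]; split => [|x xab]; [exact: smooth1Z|rewrite /= u0// mulr0].
Qed.

Lemma smooth_suppD a b u v : smooth_supp a b u -> smooth_supp a b v ->
  smooth_supp a b (u \+ v).
Proof.
by move=> [su u0] [sv v0]; split => [|x xab]; [exact: smooth1D|rewrite /= u0// v0// addr0].
Qed.

(* Approximates the indicator of the open interval (a, b) as k tends to infinity. *)
Definition smooth_bump (a b k : R) (x : R) : R := expinv 0 (k * (x - a)) * expinv 0 (k * (b - x)).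

Lemma expinv0_01 (x : R) : 0 <= expinv 0 x <= 1.
Proof.
rewrite expinv_ge0/= /expinv; case: ltP => // x0.
by rewrite expr0 mul1r expR_le1 oppr_le0 invr_ge0 ltW.
Qed.

Lemma expinv_gt0 (x : R) : 0 < x -> 0 < expinv 0 x.
Proof. by move=> x0; rewrite /expinv x0 expr0 mul1r expR_gt0. Qed.

Lemma bump_01 a b k x : 0 <= smooth_bump a b k x <= 1.
Proof.
rewrite /smooth_bump; have /andP[p0 p1] := expinv0_01 (k * (x - a)).
have /andP[q0 q1] := expinv0_01 (k * (b - x)).
by rewrite mulr_ge0//= mulr_ile1.
Qed.

Lemma bump_smooth a b k : smooth1 (smooth_bump a b k).
Proof.
apply: smooth1M.
  have := smooth1_affine k (- (k * a)) smooth1_expinv.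
  by congr smooth1; apply/funext => x; congr expinv; ring.
have := smooth1_affine (- k) (k * b) smooth1_expinv.
by congr smooth1; apply/funext => x; congr expinv; ring.
Qed.

Lemma bump_supp a b k : 0 < k -> smooth_supp a b (smooth_bump a b k).
Proof.
move=> k0; split; first exact: bump_smooth.
move=> x; rewrite negb_and -!leNgt /smooth_bump /expinv => /orP[xa|bx].
  by rewrite ifF ?mul0r//; apply/negbTE; rewrite -leNgt pmulr_rle0// subr_le0.
by rewrite [X in _ * X]ifF ?mulr0//; apply/negbTE; rewrite -leNgt pmulr_rle0// subr_le0.
Qed.

Lemma bump_gt0 a b k x : 0 < k -> a < x < b -> 0 < smooth_bump a b k x.
Proof. by move=> k0 /andP[ax xb]; rewrite mulr_gt0// expinv_gt0// mulr_gt0// subr_gt0. Qed.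

Lemma expinv_cvg1 (x : R) : 0 < x -> expinv 0 (k.+1%:R * x) @[k --> \oo] --> (1 : R).
Proof.
move=> x0.
have -> : (fun k : nat => expinv 0 (k.+1%:R * x)) = (fun k : nat => expR (- (k.+1%:R^-1 * x^-1))).
  by apply/funext => k; rewrite /expinv mulr_gt0// expr0 mul1r invfM.
rewrite -[X in _ --> X]expR0; apply: continuous_cvg; first exact: continuous_expR.
rewrite -oppr0; apply: cvgN; rewrite -(mul0r x^-1); apply: cvgMl.
exact: cvg_harmonic.
Qed.

Lemma bump_cvg1 a b x : a < x < b -> smooth_bump a b k.+1%:R x @[k --> \oo] --> (1 : R).
Proof.
move=> /andP[ax xb]; rewrite -[X in _ --> X](mulr1 1).
by apply: cvgM; apply: expinv_cvg1; rewrite subr_gt0.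
Qed.

Lemma unit_bump : exists th Th : R -> R, [/\ smooth_supp (-1) 1 th,
  forall x : R, is_derive x 1 Th (th x),
  forall x, -1 < x < 1 -> 0 < th x,
  forall x, x <= -1 -> Th x = 0 & forall x, 1 <= x -> Th x = 1].
Proof.
have n11 : -1 <= 1 :> R by lra.
have [U [dU U0 U1]] := smooth_supp_primitive (bump_supp (-1) 1 ltr01) n11.
have Upos : 0 < U 1.
  have cU : continuous U.
    move=> t; apply/differentiable_continuous/derivable1_diffP.
    by have [] := dU t.
  have n11' : -1 < 1 :> R by lra.
  (* The total mass is twice the value of the bump at an interior point, hence positive. *)
  have [c] := MVT n11' (fun t _ => dU t) (continuous_subspaceT cU).
  rewrite in_itv/= => cax; rewrite (U0 (-1))// subr0 => ->.
  by rewrite mulr_gt0 ?bump_gt0//; lra.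
exists (fun x => (U 1)^-1 * smooth_bump (-1) 1 1 x), (fun x => (U 1)^-1 * U x); split.
- by apply: smooth_suppZ; exact: bump_supp.
- by move=> x; exact: (@is_deriveZ _ _ _ U (U 1)^-1 x 1 _ (dU x)).
- by move=> x x1; rewrite mulr_gt0 ?invr_gt0 ?bump_gt0.
- by move=> x x1; rewrite (U0 x)// mulr0.
- by move=> x x1; rewrite (U1 x)// mulVf// gt_eqF.
Qed.

End smooth_supp.

(** * Products of one-variable functions *)

Section tensor.
Context {R : realType} {n : nat}.
Local Notation V := 'rV[R]_n.+1.
Implicit Types (u : 'I_n.+1 -> R -> R) (v : R -> R) (a b : V).

Definition tensor u (x : V) : R := \prod_i u i (x ord0 i).
Definition upd u j v : 'I_n.+1 -> R -> R := fun i => if i == j then v else u i.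

Lemma tensorD1 u j x :
  tensor u x = u j (x ord0 j) * \prod_(i | i != j) u i (x ord0 i).
Proof. by rewrite /tensor (bigD1 j). Qed.

Lemma tensor_upd u j v x :
  tensor (upd u j v) x = v (x ord0 j) * \prod_(i | i != j) u i (x ord0 i).
Proof.
rewrite (tensorD1 _ j) {1}/upd eqxx; congr (_ * _).
by apply: eq_bigr => i ij; rewrite /upd (negbTE ij).
Qed.

Lemma tensor_shift u j (x : V) (t : R) :
  tensor u (t *: unitv R j + x) =
  u j (t + x ord0 j) * \prod_(i | i != j) u i (x ord0 i).
Proof.
rewrite (tensorD1 _ j) !mxE !eqxx mulr1; congr (_ * _).
by apply: eq_bigr => i ij; rewrite !mxE (negbTE ij) andbF mulr0 add0r.
Qed.

Lemma is_derive_tensor u j v (x : V) : is_derive (x ord0 j) 1 (u j) (v (x ord0 j)) ->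
  is_derive x (unitv R j) (tensor u) (tensor (upd u j v) x).
Proof.
move=> [du uv]; rewrite tensor_upd; set K := \prod_(i | _) _.
have H : h^-1 *: (tensor u (h *: unitv R j + x) - tensor u x) @[h --> (0 : R)^'] -->
    (v (x ord0 j) * K).
  rewrite -uv (_ : (fun h => _) =
    (fun h : R => h^-1 *: (u j (h *: (1 : R) + x ord0 j) - u j (x ord0 j)) * K)).
    by apply: cvgMl; exact: du.
  apply/funext => h; rewrite tensor_shift (tensorD1 _ j) -/K /GRing.scale/= mulr1.
  by rewrite -mulrBl mulrA.
apply: DeriveDef; first by apply/cvg_ex; eexists; exact: H.
by apply/cvg_lim.
Qed.

Lemma tensor_continuous u : (forall i, continuous (u i)) -> continuous (tensor u).
Proof.
move=> cu; rewrite /tensor.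
have H (s : seq 'I_n.+1) : continuous (fun y : V => \prod_(i <- s) u i (y ord0 i)).
  elim: s => [|i s IH].
    rewrite (_ : (fun y : V => _) = cst (1 : R)); first exact: cst_continuous.
    by apply/funext => y; rewrite big_nil.
  rewrite (_ : (fun y : V => _) =
    (fun y : V => u i (y ord0 i) * \prod_(k <- s) u k (y ord0 k))); last first.
    by apply/funext => y; rewrite big_cons.
  move=> x; apply: (@continuousM _ V (fun y : V => u i (y ord0 i))); last exact: IH.
  apply: (@continuous_comp V _ _ (fun y : V => y ord0 i) (u i)); last exact: cu.
  exact: coord_continuous.
exact: H.
Qed.

Lemma partial_tensor u j v : (forall t : R, is_derive t 1 (u j) (v t)) ->
  partial j (tensor u) = tensor (upd u j v).
Proof.
move=> du; apply/funext => x; rewrite /partial.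
by have [] := @is_derive_tensor u j v x (du _).
Qed.

(** A partial derivative replaces one factor by its derivative, so iterated partials of a product
    are again products and both clauses of [smooth] reduce to one variable. *)
Lemma smooth_tensor u : (forall i, smooth1 (u i)) -> smooth (tensor u).
Proof.
move=> su s.
have [w sw ->] : exists2 w, (forall i, smooth1 (w i)) & partials s (tensor u) = tensor w.
  elim: s => [|j s [w sw E]]; first by exists u.
  have [v sv dv] := smooth1_deriv (sw j).
  exists (upd w j v); last by rewrite /= E; exact: partial_tensor.
  by move=> i; rewrite /upd; case: eqP.
split.
  by apply: tensor_continuous => i; exact: smooth1_continuous.
move=> j x; have [v sv dv] := smooth1_deriv (sw j).
by have [] := @is_derive_tensor w j v x (dv _).
Qed.

Definition tensor_supp a b u := forall i, smooth_supp (a ord0 i) (b ord0 i) (u i).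

Lemma tensor_supp_out a b u x : tensor_supp a b u -> ~ obox a b x -> tensor u x = 0.
Proof.
move=> su /existsNP[i /negP xi]; rewrite (tensorD1 _ i).
by rewrite (su i).2 ?mul0r.
Qed.

Lemma box_compact a b : compact (box a b).
Proof.
have := @rV_compact R n.+1 (fun i => `[a ord0 i, b ord0 i]%classic)
  (fun i => @segment_compact _ _ _).
congr compact; apply/seteqP; split => x H i; have := H i; rewrite /= ?in_itv//.
Qed.

Lemma tensor_test_fun (Om : set V) a b u : tensor_supp a b u -> box a b `<=` Om ->
  test_fun Om (tensor u).
Proof.
move=> su abOm.
have cl : closure [set x | tensor u x != 0] `<=` box a b.
  have cb : closed (box a b).
    by apply: compact_closed; [exact: norm_hausdorff|exact: box_compact].
  move/closure_id: cb => ->; apply: closure_subset => x /= ux i.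
  have : obox a b x by apply: contrapT => /(tensor_supp_out su)/eqP; apply/negP.
  by move=> /(_ i)/andP[/ltW -> /ltW ->].
split; first by apply: smooth_tensor => i; exact: (su i).1.
split; last exact: subset_trans abOm.
by apply: subclosed_compact cl; [exact: closed_closure|exact: box_compact].
Qed.

Lemma tensor_supp_upd a b u j v : tensor_supp a b u ->
  smooth_supp (a ord0 j) (b ord0 j) v -> tensor_supp a b (upd u j v).
Proof. by move=> su sv i; rewrite /upd; case: eqP => // ->. Qed.

Lemma tensor_bounded u : (forall i, exists2 M, 0 <= M & forall t, `|u i t| <= M) ->
  exists2 M, 0 <= M & forall x, `|tensor u x| <= M.
Proof.
move=> ub.
have [M HM] := @choice _ _ (fun i M => 0 <= M /\ forall t, `|u i t| <= M)
  (fun i => let: ex_intro2 M a b := ub i in ex_intro _ M (conj a b)).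
exists (\prod_i M i); first by apply: prodr_ge0 => i _; exact: (HM i).1.
by move=> x; rewrite normr_prod; apply: ler_prod => i _; rewrite normr_ge0 (HM i).2.
Qed.

Lemma tensor_supp_bounded a b u : tensor_supp a b u ->
  exists2 M, 0 <= M & forall x, `|tensor u x| <= M.
Proof. by move=> su; apply: tensor_bounded => i; exact: smooth_supp_bounded (su i). Qed.

Lemma measurable_tensor a b u : tensor_supp a b u ->
  measurable_fun setT (tensor u : lebT R n -> R).
Proof.
move=> su; apply: measurable_prod => i _.
apply: (measurableT_comp (f := u i)); last exact: measurable_coord.
by apply: continuous_measurable_fun; exact: smooth1_continuous (su i).1.
Qed.

End tensor.

(** * Integrals against bounded functions, and translations *)

Section bounded_integrals.
Context d (T : measurableType d) {R : realType} (mu : {measure set T -> \bar R}).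

Lemma integrableMbounded (D : set T) (f h : T -> R) (M : R) : measurable D ->
  mu.-integrable D (EFin \o f) -> measurable_fun D h -> (forall x, D x -> `|h x| <= M) ->
  mu.-integrable D (EFin \o (fun x => f x * h x)).
Proof.
move=> mD /[dup] fi /measurable_int/measurable_EFinP mf mh hM.
apply: (@le_integrable _ _ _ mu D mD _ (fun x => M%:E * (f x)%:E)%E); last exact: integrableZl.
  by apply/measurable_EFinP; exact: measurable_funM.
move=> x Dx /=; rewrite lee_fin !normrM mulrC ler_wpM2r//.
by rewrite (le_trans (hM _ Dx))// ler_norm.
Qed.

Lemma bounded_supp_integrable (D : set T) (h : T -> R) (M : R) : measurable D ->
  (mu D < +oo)%E -> measurable_fun setT h -> (forall x, `|h x| <= M) ->
  (forall x, ~ D x -> h x = 0) -> mu.-integrable setT (EFin \o h).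
Proof.
move=> mD Doo mh hM h0.
have : mu.-integrable D (EFin \o h).
  apply: measurable_bounded_integrable => //.
    exact: measurable_funTS.
  exists M; split; first exact: num_real.
  by move=> r Mr x _ /=; rewrite (le_trans (hM x))// ltW.
rewrite -[D in mu.-integrable D]setTI => /(integrable_restrict _ mD measurableT).
suff -> : (EFin \o h) \_ D = EFin \o h by [].
apply/funext => x; rewrite patchE/=.
by case: ifPn => // /negP xD; rewrite h0// => Dx; apply: xD; exact/mem_set.
Qed.

Lemma Rintegral_supp (D E : set T) (h : T -> R) : measurable D -> measurable E ->
  D `<=` E -> (forall x, E x -> ~ D x -> h x = 0) ->
  (\int[mu]_(x in E) h x = \int[mu]_(x in D) h x)%R.
Proof.
move=> mD mE DE h0; rewrite -[in RHS](setIidr DE) Rintegral_mkcondr.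
apply: eq_Rintegral => x /set_mem Ex; rewrite patchE; case: ifPn => // /negP xD.
by rewrite h0// => Dx; apply: xD; exact/mem_set.
Qed.

Lemma cvg_Rintegral_bounded (D : set T) (f : T -> R) (h_ : nat -> T -> R) (h : T -> R)
    (M : R) : measurable D ->
  mu.-integrable D (EFin \o f) -> (forall k, measurable_fun D (h_ k)) ->
  measurable_fun D h ->
  (forall k x, D x -> `|h_ k x| <= M) -> (forall x, D x -> h_ k x @[k --> \oo] --> h x) ->
  (\int[mu]_(x in D) (f x * h_ k x))%R @[k --> \oo] --> (\int[mu]_(x in D) (f x * h x))%R.
Proof.
move=> mD fi mh_ mh hM hcvg.
have mf : measurable_fun D f by move/measurable_int : fi => /measurable_EFinP.
have [|||||hi _ H] := @dominated_convergence _ _ _ mu D mD (fun k x => (f x * h_ k x)%:E)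
    (fun x => (f x * h x)%:E) (fun x => `|M%:E * (f x)%:E|)%E.
- by move=> k; apply/measurable_EFinP; exact: measurable_funM.
- by apply/measurable_EFinP; exact: measurable_funM.
- apply/aeW => x Dx; apply/cvg_EFin; first exact: nearW.
  by apply: cvgMr; exact: hcvg.
- by apply: integrable_abse; exact: integrableZl.
- apply/aeW => x k Dx; rewrite lee_fin/= !normrM mulrC ler_wpM2r//.
  by rewrite (le_trans (hM _ _ Dx))// ler_norm.
have hf := integrable_fin_num mD hi.
by apply: fine_cvg; rewrite /Rintegral fineK.
Qed.

End bounded_integrals.

Section translation.
Context {R : realType} {n : nat}.
Local Notation V := 'rV[R]_n.+1.
Local Notation T := (lebT R n).
Local Notation mu := (@lebm R n).

Definition translate (v : V) : T -> T := fun x => ((x : V) + v : V).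

Lemma measurable_translate (v : V) : measurable_fun setT (translate v).
Proof.
move=> _ A mA; rewrite setTI.
change (caratheodory_measurable (@leb R n.+1) (translate v @^-1` A)) => X.
have E (B : set V) : leb (B `&` translate v @^-1` A) =
    leb ([set x | B (x - v)] `&` A).
  rewrite -[RHS](leb_translate v); congr leb.
  by apply/seteqP; split => x /=; rewrite addrK.
have Ec : leb (X `&` ~` (translate v @^-1` A)) = leb ([set x | X (x - v)] `&` ~` A).
  rewrite -[RHS](leb_translate v); congr leb.
  by apply/seteqP; split => x /=; rewrite addrK.
by rewrite E Ec -(leb_translate (- v) X); exact: (mA [set x | X (x - v)]).
Qed.

Lemma Rintegral_translate (v : V) (f : T -> R) : measurable_fun setT f ->
  mu.-integrable setT (EFin \o (f \o translate v)) ->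
  (\int[mu]_x f (translate v x) = \int[mu]_x f x)%R.
Proof.
move=> mf fi; rewrite /Rintegral; congr fine.
have mt := measurable_translate v.
have mEf : measurable_fun setT (EFin \o f) by exact/measurable_EFinP.
have := @integral_pushforward _ _ _ _ R _ mt mu setT (EFin \o f) mEf.
rewrite preimage_setT => /(_ fi measurableT) <-.
apply: eq_measure_integral => A mA _.
exact: (leb_translate v A).
Qed.

Lemma box_fin (a b : V) : (mu (box a b) < +oo)%E.
Proof. by rewrite /lebm leb_box ltry. Qed.

Lemma obox_fin (a b : V) : (mu (obox a b) < +oo)%E.
Proof.
apply: le_lt_trans (box_fin a b); apply: leb_mono => x xab i.
by have /andP[/ltW -> /ltW ->] := xab i.
Qed.

(** Difference quotients have integral 0 by translation invariance and are uniformly bounded by the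
    mean value inequality, so dominated convergence applies. The result says that constants have
    zero weak derivatives, which lets [poincare_cube] replace g by g - c. *)
Lemma Rintegral_partial_tensor (a b : V) (u : 'I_n.+1 -> R -> R) j v :
  tensor_supp a b u -> (forall t : R, is_derive t 1 (u j) (v t)) ->
  smooth_supp (a ord0 j) (b ord0 j) v ->
  (\int[mu]_x tensor (upd u j v) x = 0)%R.
Proof.
move=> su dv sv.
have suv : tensor_supp a b (upd u j v) by exact: tensor_supp_upd.
have [M M0 uM] := tensor_supp_bounded su.
have [v' sv' dv'] := smooth1_deriv sv.1.
(* All steps [t_ k] are at most 1, so this enlarged box contains the supports of all the
   translates. *)
pose E : set T := box (a - const_mx 1) (b + const_mx 1).
have mE : measurable E by exact: measurable_box.
have Efin : (mu E < +oo)%E by exact: box_fin.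
have mu_ : measurable_fun setT (tensor u : T -> R) by exact: measurable_tensor su.
pose t_ k : R := k.+1%:R^-1.
have t0 k : 0 < t_ k by rewrite invr_gt0.
have t1 k : t_ k <= 1 by rewrite invf_le1// ler1n.
pose w k : V := t_ k *: unitv R j.
have mtr k : measurable_fun setT (tensor u \o translate (w k) : T -> R).
  by apply: (measurableT_comp mu_); exact: measurable_translate.
have trE k (x : T) : translate (w k) x = t_ k *: unitv R j + (x : V) by exact: addrC.
have out k x : ~ E x -> tensor u (translate (w k) x) = 0.
  move=> xE; apply: (tensor_supp_out su) => h; apply: xE => i.
  have := h i; rewrite !mxE eqxx/=.
  have := t0 k; have := t1 k; move: (t_ k) => t; case: eqP => _ /=; lra.
have out0 x : ~ E x -> tensor u x = 0.
  move=> xE; apply: (tensor_supp_out su) => h; apply: xE => i.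
  by have := h i; rewrite !mxE; lra.
have iu : mu.-integrable setT (EFin \o (tensor u : T -> R)).
  exact: (bounded_supp_integrable (M := M) mE).
have itr k : mu.-integrable setT (EFin \o (tensor u \o translate (w k) : T -> R)).
  apply: (bounded_supp_integrable (M := M) mE) => //.
    by move=> x; exact: uM.
  by move=> x; exact: out.
pose D k (x : T) : R := k.+1%:R * (tensor u (translate (w k) x) - tensor u x).
have iD k : (\int[mu]_x D k x = 0)%R.
  rewrite /D RintegralZl//; last exact: (integrableB _ (itr k) iu).
  have Et := Rintegral_translate mu_ (itr k).
  rewrite RintegralB//; last exact: (itr k).
  by rewrite [X in _ * (X - _)]Et subrr mulr0.
have sD k : (\int[mu]_x D k x = \int[mu]_(x in E) (1 * D k x))%R.
  rewrite (@Rintegral_supp _ _ _ _ E)//.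
    by apply: eq_Rintegral => x _; rewrite mul1r.
  by move=> x _ xE; rewrite /D out// out0// subrr mulr0.
have [M' M'0 vM'] := smooth_supp_bounded sv.
have [K K0 uK] : exists2 K, 0 <= K & forall x : V, `|\prod_(i | i != j) u i (x ord0 i)| <= K.
  have [|K K0 uK] := @tensor_bounded _ _ (upd u j (cst 1)).
    move=> i; rewrite /upd; case: eqP => _; last exact: smooth_supp_bounded (su i).
    by exists 1 => // t; rewrite normr1.
  by exists K => // x; have := uK x; rewrite tensor_upd mul1r.
have DM k x : `|D k x| <= M' * K.
  rewrite /D trE tensor_shift (tensorD1 u j) -mulrBl mulrA normrM.
  apply: ler_pM => //; rewrite normrM ger0_norm//.
  have H : `|u j (t_ k + (x : V) ord0 j) - u j ((x : V) ord0 j)| <= M' * t_ k.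
    rewrite -[X in _ <= _ * X](addrK ((x : V) ord0 j)).
    by apply: (mvt_le _ dv) => //; rewrite lerDr ltW.
  rewrite (le_trans (ler_wpM2l _ H))//.
  by rewrite mulrCA /t_ divff ?mulr1.
have cvgD x : D k x @[k --> \oo] --> tensor (upd u j v) x.
  have [du <-] := @is_derive_tensor _ _ u j v x (dv _).
  have /cvgr_dnbhsP/(_ t_) := du.
  have -> : (fun k => (t_ k)^-1 *: (tensor u (t_ k *: unitv R j + x) - tensor u x)) = D ^~ x.
    by apply/funext => k; rewrite /D trE /t_ invrK.
  apply; split; last exact: cvg_harmonic.
  by move=> k; rewrite gt_eqF.
have mD k : measurable_fun setT (D k).
  have m1 : measurable_fun setT (fun x : T => tensor u (translate (w k) x) - tensor u x).
    exact: (measurable_funB (mtr k) mu_).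
  have m2 := @mulrl_measurable R setT (k.+1%:R : R).
  by have := measurableT_comp m2 m1.
have iE : mu.-integrable E (EFin \o (cst 1 : T -> R)).
  apply: measurable_bounded_integrable => //.
  by exists 1; split => // r r1 x _ /=; rewrite normr1 ltW.
have sv0 : (\int[mu]_(x in E) (1 * tensor (upd u j v) x) = \int[mu]_x tensor (upd u j v) x)%R.
  rewrite [RHS](@Rintegral_supp _ _ _ mu E)//.
    by apply: eq_Rintegral => x _; rewrite mul1r.
  move=> x _ xE; apply: (tensor_supp_out suv) => h; apply: xE => i.
  by have := h i; rewrite !mxE; lra.
have := @cvg_Rintegral_bounded _ _ _ mu E (cst 1) D (tensor (upd u j v)) (M' * K)
  mE iE (fun k => measurable_funTS (mD k)) (measurable_funTS (measurable_tensor suv))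
  (fun k x _ => DM k x) (fun x _ => cvgD x).
under eq_fun do rewrite -sD iD.
rewrite -sv0; move/cvg_lim => <- //.
by rewrite lim_cst.
Qed.

End translation.

Section tensor_span.
Context {R : realType} {n : nat}.
Local Notation V := 'rV[R]_n.+1.
Local Notation T := (lebT R n).
Local Notation mu := (@lebm R n).
Local Notation fam := ('I_n.+1 -> R -> R).
Implicit Types (S : set fam) (a b : V).

(** Linear combinations are needed because approximate signs are sums of products. The parameter [S]
    records how many factors of each product have already been averaged. *)
Inductive tspan S : (V -> R) -> Prop :=
| tspan0 : tspan S (fun=> 0)
| tspanD c u psi : S u -> tspan S psi -> tspan S (fun x => c * tensor u x + psi x).

Lemma tspan_tensor S u : S u -> tspan S (tensor u).
Proof.
move=> Su; rewrite (_ : tensor u = (fun x => 1 * tensor u x + 0)).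
  by apply: tspanD => //; exact: tspan0.
by apply/funext => x; rewrite mul1r addr0.
Qed.

Lemma tspan_lin S c phi psi : tspan S phi -> tspan S psi ->
  tspan S (fun x => c * phi x + psi x).
Proof.
move=> + Spsi; elim=> [|c' u {}phi Su _ IH].
  by rewrite (_ : (fun x => _) = psi)//; apply/funext => x; rewrite mulr0 add0r.
rewrite (_ : (fun x => _) = (fun x => (c * c') * tensor u x + (c * phi x + psi x))).
  exact: tspanD.
by apply/funext => x; ring.
Qed.

Lemma tspan_sub S S' phi : S `<=` S' -> tspan S phi -> tspan S' phi.
Proof.
move=> SS'; elim=> [|c u psi Su _ IH]; first exact: tspan0.
by apply: tspanD => //; exact: SS'.
Qed.

Definition fam_mul (u w : fam) : fam := fun i t => u i t * w i t.

Lemma tensor_mul u w x : tensor (fam_mul u w) x = tensor u x * tensor w x.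
Proof. by rewrite /tensor big_split. Qed.

Lemma tspan_mul a b w phi : (forall i, smooth1 (w i)) ->
  tspan (tensor_supp a b) phi -> tspan (tensor_supp a b) (fun x => phi x * tensor w x).
Proof.
move=> sw; elim=> [|c u psi Su _ IH].
  by rewrite (_ : (fun x => _) = (fun=> 0)); [exact: tspan0|apply/funext => x; rewrite mul0r].
rewrite (_ : (fun x => _) = (fun x => c * tensor (fam_mul u w) x + psi x * tensor w x)).
  by apply: tspanD => // i; exact: smooth_suppM (Su i) (sw i).
by apply/funext => x; rewrite tensor_mul; ring.
Qed.

Lemma tspan_measurable a b phi : tspan (tensor_supp a b) phi ->
  measurable_fun setT (phi : T -> R).
Proof.
elim=> [|c u psi Su _ IH]; first exact: measurable_cst.
have m1 := measurableT_comp (@mulrl_measurable R setT c) (measurable_tensor Su).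
exact: (measurable_funD m1 IH).
Qed.

Lemma tspan_bounded a b phi : tspan (tensor_supp a b) phi ->
  exists2 M, 0 <= M & forall x, `|phi x| <= M.
Proof.
elim=> [|c u psi Su _ [M M0 HM]]; first by exists 0 => // x; rewrite normr0.
have [N N0 HN] := tensor_supp_bounded Su.
exists (`|c| * N + M); first by rewrite addr_ge0 ?mulr_ge0.
by move=> x; rewrite (le_trans (ler_normD _ _))// lerD// normrM ler_wpM2l.
Qed.

End tensor_span.

(** * Poincaré's inequality *)

Section averaging.
Context {R : realType} {n : nat}.
Local Notation V := 'rV[R]_n.+1.
Local Notation T := (lebT R n).
Local Notation mu := (@lebm R n).
Local Notation fam := ('I_n.+1 -> R -> R).
Variables (a b : V) (th Th : fam).
Hypothesis ab : forall i, a ord0 i <= b ord0 i.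
Hypothesis sth : tensor_supp a b th.
Hypothesis dTh : forall i (t : R), is_derive t 1 (Th i) (th i t).
Hypothesis Tha : forall i t, t <= a ord0 i -> Th i t = 0.
Hypothesis Thb : forall i t, b ord0 i <= t -> Th i t = 1.
Variables (g : T -> R) (h : 'I_n.+1 -> T -> R).
Hypothesis ig : mu.-integrable (obox a b) (EFin \o g).
Hypothesis ih : forall j, mu.-integrable (obox a b) (EFin \o h j).
Local Notation Q := (obox a b).

(* The first j factors have been replaced by the fixed unit-mass bumps th i; Th i is the
   primitive of th i. *)
Definition averaged (j : nat) : set fam :=
  [set u | tensor_supp a b u /\ forall i : 'I_n.+1, (i < j)%N -> u i = th i].

Hypothesis weak : forall j u v, tensor_supp a b u ->
  (forall t : R, is_derive t 1 (u j) (v t)) -> smooth_supp (a ord0 j) (b ord0 j) v ->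
  (\int[mu]_(x in Q) (g x * tensor (upd u j v) x) =
   - \int[mu]_(x in Q) (h j x * tensor u x))%R.

Let mQ : measurable (Q : set T) := measurable_obox a b.

Lemma integrable_tspan (f : T -> R) phi : mu.-integrable Q (EFin \o f) ->
  tspan (tensor_supp a b) phi -> mu.-integrable Q (EFin \o (fun x : T => f x * phi x)).
Proof.
move=> fi Sphi; have [M _ HM] := tspan_bounded Sphi.
apply: (integrableMbounded (M := M)) => //.
exact: measurable_funTS (tspan_measurable Sphi).
Qed.

(* psi' is the average of psi in the coordinate j; psi - psi' is the j-th derivative of phi, a
   primitive W of psi corrected by a multiple of Th j so as to be compactly supported. *)
Lemma average_step (j : 'I_n.+1) psi : tspan (averaged j) psi ->
  exists psi' phi (W : V -> R -> R),
    [/\ tspan (averaged j.+1) psi', tspan (tensor_supp a b) phi,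
     (\int[mu]_(x in Q) (g x * psi x) - \int[mu]_(x in Q) (g x * psi' x) =
      - \int[mu]_(x in Q) (h j x * phi x))%R,
     (forall x, psi' x = W x (b ord0 j) * th j (x ord0 j) /\
        phi x = W x (x ord0 j) - W x (b ord0 j) * Th j (x ord0 j)) &
     (forall x, W x (a ord0 j) = 0 /\
       forall t : R, is_derive t 1 (W x) (psi (setc x j t)))].
Proof.
have sub k : averaged k `<=` tensor_supp a b by move=> u [].
elim=> [|c u {}psi Su Spsi [psi' [phi [W [Spsi' Sphi E Ex dW]]]]].
  exists (fun=> 0), (fun=> 0), (fun _ _ => 0); split; try exact: tspan0.
  - under eq_Rintegral do rewrite mulr0.
    under [in RHS]eq_Rintegral do rewrite mulr0.
    by rewrite Rintegral_cst// mul0r subrr oppr0.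
  - by move=> x; rewrite !mul0r subrr.
  - by move=> x; split => // t; exact: is_derive_cst.
have [su uth] := Su.
have [U [dU Ua Ub]] := smooth_supp_primitive (su j) (ab j).
pose v t := U t - U (b ord0 j) * Th j t.
have dv : forall t : R, is_derive t 1 v (u j t - U (b ord0 j) * th j t).
  by move=> t; apply: (is_deriveB (dU t)).
have sv' : smooth_supp (a ord0 j) (b ord0 j) (fun t => u j t - U (b ord0 j) * th j t).
  have := smooth_suppD (su j) (smooth_suppZ (- U (b ord0 j)) (sth j)).
  by congr smooth_supp; apply/funext => t /=; rewrite mulNr.
have sv : smooth_supp (a ord0 j) (b ord0 j) v.
  split; first exact: smooth1_primitive sv'.1 dv.
  move=> t; rewrite negb_and -!leNgt /v => /orP[ta|bt].
    by rewrite Ua// Tha// mulr0 subr0.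
  by rewrite (Ub t)// Thb// mulr1 subrr.
pose u1 := upd u j (th j); pose u2 := upd u j v.
have Su1 : averaged j.+1 u1.
  split; first exact: tensor_supp_upd.
  move=> i ij; rewrite /u1 /upd; case: ifPn => [/eqP ->//|nij].
  by apply: uth; rewrite ltn_neqAle -ltnS ij andbT.
have Su2 : tensor_supp a b u2 by exact: tensor_supp_upd.
pose K (x : V) := \prod_(i | i != j) u i (x ord0 i).
(* The function [W] adds up the primitives of all terms: it is a primitive of the whole of psi along
   the coordinate [j], so later bounds depend on the supremum of |psi| and not on its
   decomposition. *)
exists (fun x => (c * U (b ord0 j)) * tensor u1 x + psi' x).
exists (fun x => c * tensor u2 x + phi x), (fun x t => c * K x * U t + W x t); split.
- exact: tspanD.
- exact: tspanD.
- have ipsi := integrable_tspan ig (tspan_sub (@sub _) Spsi).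
  have ipsi' := integrable_tspan ig (tspan_sub (@sub _) Spsi').
  have iphi := integrable_tspan (ih j) Sphi.
  have iu := integrable_tspan ig (tspan_tensor su).
  have iu1 := integrable_tspan ig (tspan_tensor Su1.1).
  have iu2 := integrable_tspan (ih j) (tspan_tensor Su2).
  have lin (f phi1 phi2 : T -> R) e : mu.-integrable Q (EFin \o (fun x => f x * phi1 x)) ->
     mu.-integrable Q (EFin \o (fun x => f x * phi2 x)) ->
     (\int[mu]_(x in Q) (f x * (e * phi1 x + phi2 x)) =
      e * \int[mu]_(x in Q) (f x * phi1 x) + \int[mu]_(x in Q) (f x * phi2 x))%R.
    move=> i1 i2; rewrite -RintegralZl// -RintegralD//; last first.
      exact: (integrableZl _ e i1).
    by apply: eq_Rintegral => x _; ring.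
  rewrite !lin//.
  have u2j : u2 j = v by rewrite /u2 /upd eqxx.
  have upd2 w : upd u2 j w = upd u j w by apply/funext => i; rewrite /u2 /upd; case: eqP.
  have := weak (u := u2) (v := fun t => u j t - U (b ord0 j) * th j t) Su2 _ sv'.
  rewrite u2j upd2 => /(_ dv) H.
  have {}H : (\int[mu]_(x in Q) (g x * tensor u x) -
      U (b ord0 j) * \int[mu]_(x in Q) (g x * tensor u1 x) =
      - \int[mu]_(x in Q) (h j x * tensor u2 x))%R.
    rewrite -H -RintegralZl// -RintegralB//; last exact: (integrableZl _ (U (b ord0 j)) iu1).
    apply: eq_Rintegral => x _; rewrite (tensorD1 u j) tensor_upd -/(K x).
    by rewrite tensor_upd -/(K x); ring.
  move: E H.
  move: (\int[mu]_(x in Q) (g x * psi x))%R (\int[mu]_(x in Q) (g x * psi' x))%R => A1 A2.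
  move: (\int[mu]_(x in Q) (h j x * phi x))%R (\int[mu]_(x in Q) (g x * tensor u x))%R => A3 A4.
  move: (\int[mu]_(x in Q) (g x * tensor u1 x))%R (\int[mu]_(x in Q) (h j x * tensor u2 x))%R => A5 A6.
  move=> E H; transitivity (c * (A4 - U (b ord0 j) * A5) + (A1 - A2)); first by ring.
  by rewrite H E; ring.
- move=> x; have [-> ->] := Ex x; rewrite !tensor_upd -/(K x) /v.
  by split; ring.
- move=> x; have [W0 dWx] := dW x; split; first by rewrite Ua// mulr0 add0r.
  move=> t; apply: is_deriveD => //.
  have := @is_deriveZ _ _ _ U (c * K x) t 1 _ (dU t).
  move/is_derive_eq; apply; rewrite /GRing.scale/= (tensorD1 u j) !mxE eqxx.
  rewrite -mulrA [K x * _]mulrC; congr (_ * (_ * _)).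
  by apply: eq_bigr => i ij; rewrite mxE (negbTE ij).
Qed.

Variables (r kappa : R).
Hypothesis r0 : 0 < r.
Hypothesis kappa1 : 1 <= 2 * kappa.
Hypothesis abr : forall i, b ord0 i - a ord0 i = 2 * r.
Hypothesis thK : forall i t, `|th i t| <= kappa / r.

Let kappa0 : 0 <= 2 * kappa. Proof. exact: le_trans kappa1. Qed.

(** A primitive of psi over a side of length 2r is at most 2rM. Multiplying by th <= kappa/r gives 2
    kappa M for the average, and Th <= 2 kappa gives 2rM + 2rM 2 kappa for the corrected
    primitive. *)
Lemma average_bound (j : 'I_n.+1) psi M : 0 <= M -> tspan (averaged j) psi ->
  (forall x, `|psi x| <= M) ->
  exists2 psi', tspan (averaged j.+1) psi' &
   (forall x, `|psi' x| <= 2 * kappa * M) /\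
   (`|\int[mu]_(x in Q) (g x * psi x) - \int[mu]_(x in Q) (g x * psi' x)| <=
     2 * r * (1 + 2 * kappa) * M * \int[mu]_(x in Q) `|h j x|)%R.
Proof.
move=> M0 Spsi psiM; have [psi' [phi [W [Spsi' Sphi E Ex dW]]]] := average_step Spsi.
have WM x t : a ord0 j <= t -> `|W x t| <= M * (t - a ord0 j).
  move=> at_; have [W0 dWx] := dW x; rewrite -[W x t]subr0 -W0.
  by apply: (mvt_le at_ dWx) => s _; exact: psiM.
have WMb x : `|W x (b ord0 j)| <= M * (2 * r) by rewrite -(abr j) WM.
exists psi' => //; split.
  move=> x; rewrite (Ex x).1 normrM.
  apply: (@le_trans _ _ (M * (2 * r) * (kappa / r))); first exact: ler_pM.
  rewrite le_eqVlt; apply/orP; left; apply/eqP; field.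
  by rewrite gt_eqF.
have ThM (x : V) : Q x -> `|Th j (x ord0 j)| <= 2 * kappa.
  move=> /(_ j)/andP[/ltW ax /ltW xb].
  rewrite -[Th j _]subr0 -(Tha (lexx (a ord0 j))).
  apply: (le_trans (mvt_le ax (dTh j) (fun t _ => thK j t))).
  apply: (@le_trans _ _ (kappa / r * (2 * r))).
    rewrite ler_wpM2l ?divr_ge0 ?(ltW r0)//; last by rewrite -(abr j) lerB.
    by rewrite -(pmulr_rge0 kappa (ltr0n _ 2)).
  rewrite le_eqVlt; apply/orP; left; apply/eqP; field.
  by rewrite gt_eqF.
have phiM (x : V) : Q x -> `|phi x| <= 2 * r * (1 + 2 * kappa) * M.
  move=> Qx; rewrite (Ex x).2; have /andP[/ltW ax /ltW xb] := Qx j.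
  apply: (le_trans (ler_normB _ _)).
  rewrite (_ : _ * M = M * (2 * r) + M * (2 * r) * (2 * kappa)); last by ring.
  apply: lerD.
    apply: (le_trans (WM x _ ax)); rewrite ler_wpM2l// -(abr j).
    by rewrite lerB.
  by rewrite normrM; apply: ler_pM => //; exact: ThM.
rewrite E normrN.
have ihp := integrable_tspan (ih j) Sphi.
apply: (le_trans (le_normr_Rintegral mQ ihp)).
have iah := integrable_norm (ih j).
rewrite -RintegralZl//; apply: le_Rintegral => //.
- exact: (integrable_norm ihp).
- exact: (integrableZl _ (2 * r * (1 + 2 * kappa) * M) iah).
by move=> x Qx; rewrite normrM mulrC ler_wpM2r// phiM.
Qed.

(** Each averaging costs one partial derivative and multiplies the supremum bound by 2 kappa. As 2
    kappa >= 1, the power n+1 bounds all intermediate factors and the errors add up by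
    telescoping. *)
Lemma averages_bound k psi : (k <= n.+1)%N -> tspan (tensor_supp a b) psi ->
  (forall x, `|psi x| <= 1) ->
  exists2 psi', tspan (averaged k) psi' &
   (forall x, `|psi' x| <= (2 * kappa) ^+ k) /\
   (`|\int[mu]_(x in Q) (g x * psi x) - \int[mu]_(x in Q) (g x * psi' x)| <=
     2 * r * (1 + 2 * kappa) * (2 * kappa) ^+ n.+1 *
     \sum_(j < n.+1 | (j < k)%N) \int[mu]_(x in Q) `|h j x|)%R.
Proof.
move=> kn Spsi psi1; elim: k kn => [_|k IH kn].
  exists psi; first by apply: tspan_sub Spsi => u su.
  by split => //; rewrite subrr normr0 big_pred0// mulr0.
have [psi' Spsi' [psi'M E]] := IH (ltnW kn).
have kn' : (k < n.+1)%N by [].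
have KM0 : 0 <= (2 * kappa) ^+ k by rewrite exprn_ge0.
have [psi2 Spsi2 [psi2M E2]] := @average_bound (Ordinal kn') psi' _ KM0 Spsi' psi'M.
exists psi2 => //; split; first by move=> x; rewrite exprS.
have := ler_normD (\int[mu]_(x in Q) (g x * psi x) - \int[mu]_(x in Q) (g x * psi' x))%R
  (\int[mu]_(x in Q) (g x * psi' x) - \int[mu]_(x in Q) (g x * psi2 x))%R.
rewrite subrKA => /le_trans; apply.
rewrite [leRHS](_ : _ = 2 * r * (1 + 2 * kappa) * (2 * kappa) ^+ n.+1 *
     (\sum_(j < n.+1 | (j < k)%N) \int[mu]_(x in Q) `|h j x|) +
     2 * r * (1 + 2 * kappa) * (2 * kappa) ^+ n.+1 * \int[mu]_(x in Q) `|h (Ordinal kn') x|).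
  apply: lerD => //; apply: (le_trans E2).
  apply: ler_wpM2r; first exact: Rintegral_ge0.
  apply: ler_wpM2l; first by rewrite !mulr_ge0 ?addr_ge0// ltW.
  by apply: ler_weXn2l => //; exact: ltnW.
rewrite -mulrDr; congr (_ * _).
rewrite (bigD1 (Ordinal kn'))/= ?ltnSn// addrC; congr (_ + _).
apply: eq_bigl => j; rewrite ltnS ltn_neqAle andbC; congr (_ && _).
Qed.

Lemma averaged_last psi : tspan (averaged n.+1) psi ->
  exists C, forall x, psi x = C * tensor th x.
Proof.
elim=> [|c u {}psi [_ uth] _ [C IH]]; first by exists 0 => x; rewrite mul0r.
have -> : u = th by apply/funext => i; exact: uth.
by exists (c + C) => x; rewrite IH; ring.
Qed.

(** After all coordinates have been averaged only a multiple of [tensor th] is left, and g is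
    orthogonal to it; the pairing with psi is then pure averaging error. *)
Lemma oscillation_pairing psi : (\int[mu]_(x in Q) (g x * tensor th x) = 0)%R ->
  tspan (tensor_supp a b) psi -> (forall x, `|psi x| <= 1) ->
  (`|\int[mu]_(x in Q) (g x * psi x)| <=
     2 * r * (1 + 2 * kappa) * (2 * kappa) ^+ n.+1 *
     \sum_(j < n.+1) \int[mu]_(x in Q) `|h j x|)%R.
Proof.
move=> g0 Spsi psi1.
have [psi' /averaged_last[C psi'E] [_]] := averages_bound (leqnn _) Spsi psi1.
rewrite (_ : (\int[mu]_(x in Q) (g x * psi' x))%R = 0) ?subr0.
  by under eq_bigl do rewrite ltn_ord.
transitivity (C * \int[mu]_(x in Q) (g x * tensor th x))%R; last by rewrite g0 mulr0.
rewrite -RintegralZl//; last exact: (integrable_tspan ig (tspan_tensor sth)).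
by apply: eq_Rintegral => x _; rewrite psi'E; ring.
Qed.

End averaging.

(** * Recovering L1 norms from products by duality *)

Section duality.
Context {R : realType} {n : nat}.
Local Notation V := 'rV[R]_n.+1.
Local Notation T := (lebT R n).
Local Notation mu := (@lebm R n).
Implicit Types (a b : V).

Definition bump_fam (c : V * V) (k : nat) : 'I_n.+1 -> R -> R :=
  fun i => smooth_bump (c.1 ord0 i) (c.2 ord0 i) k.+1%:R.
Definition bumpn c k : V -> R := tensor (bump_fam c k).

Lemma bumpn_01 c k x : 0 <= bumpn c k x <= 1.
Proof.
apply/andP; split.
  by apply: prodr_ge0 => i _; have /andP[] := bump_01 (c.1 ord0 i) (c.2 ord0 i) k.+1%:R (x ord0 i).
by apply: prodr_ile1 => i _; exact: bump_01.
Qed.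

Lemma bumpn_supp c k : tensor_supp c.1 c.2 (bump_fam c k).
Proof. by move=> i; exact: bump_supp. Qed.

Lemma bumpn_out c k x : ~ obox c.1 c.2 x -> bumpn c k x = 0.
Proof. exact: tensor_supp_out (@bumpn_supp c k). Qed.

Lemma bumpn_cvg c x : obox c.1 c.2 x -> bumpn c k x @[k --> \oo] --> (1 : R).
Proof.
move=> cx; rewrite /bumpn /tensor.
have H (s : seq 'I_n.+1) : (fun k => \prod_(i <- s) bump_fam c k i (x ord0 i)) @ \oo --> (1 : R).
  elim: s => [|i s IH].
    by rewrite (_ : (fun k : nat => _) = cst 1); [exact: cvg_cst|
      apply/funext => k; rewrite big_nil].
  rewrite (_ : (fun k : nat => _) =
    (fun k => bump_fam c k i (x ord0 i) * \prod_(i <- s) bump_fam c k i (x ord0 i))); last first.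
    by apply/funext => k; rewrite big_cons.
  by rewrite -[X in _ --> X](mulr1 1); apply: cvgM => //; exact: bump_cvg1.
exact: H.
Qed.

Section box_cover.
Variable c : nat -> V * V.

(* Approximates the indicator of the complement of the union of the open boxes c m. *)
Definition gap k M (x : V) : R := \prod_(m < M) (1 - bumpn (c m) k x).

Lemma gap_01 k M x : 0 <= gap k M x <= 1.
Proof.
have H m : 0 <= 1 - bumpn (c m) k x <= 1 by have := bumpn_01 (c m) k x; lra.
by apply/andP; split; [apply: prodr_ge0 => m _; have /andP[] := H m|apply: prodr_ile1].
Qed.

Lemma gap_out k M x : ~ (\bigcup_m obox (c m).1 (c m).2) x -> gap k M x = 1.
Proof.
move=> xU; rewrite /gap big1// => m _; rewrite bumpn_out ?subr0// => xm.
by apply: xU; exists m.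
Qed.

Lemma gap_cvg x : (\bigcup_m obox (c m).1 (c m).2) x -> gap k k x @[k --> \oo] --> (0 : R).
Proof.
move=> [m _ xm].
apply: (@squeeze_cvgr _ _ _ _ (cst 0) (fun k => 1 - bumpn (c m) k x)).
- near=> k; have /andP[-> _] /= := gap_01 k k x.
  have mk : (m < k)%N by near: k; exact: nbhs_infty_gt.
  rewrite /gap (bigD1 (Ordinal mk))//= ler_piMr//.
    by have /andP[_] := bumpn_01 (c m) k x; rewrite subr_ge0.
  apply: prodr_ile1 => i _.
  by have := bumpn_01 (c i) k x; lra.
- exact: cvg_cst.
- by rewrite -[X in _ --> X](subrr 1); apply: cvgB; [exact: cvg_cst|exact: bumpn_cvg].
Unshelve. all: by end_near. Qed.

(** Inside the box from a to b it tends to 1 on the union of the open boxes [c m] and to -1 off it.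
    The single index k governs the number of boxes, the sharpness of the bumps and the cutoff. *)
Definition approx_sign a b k (x : V) : R := (1 - 2 * gap k k x) * bumpn (a, b) k x.

(** The product in [gap] is expanded one factor at a time starting from the cutoff, which keeps
    every term supported in the box from a to b, wherever the boxes [c m] lie. *)
Lemma approx_sign_tspan a b k : tspan (tensor_supp a b) (approx_sign a b k).
Proof.
have H M : tspan (tensor_supp a b) (fun x => bumpn (a, b) k x * gap k M x).
  elim: M => [|M IH].
    rewrite (_ : (fun x => _) = bumpn (a, b) k).
      exact: (tspan_tensor (@bumpn_supp (a, b) k)).
    by apply/funext => x; rewrite /gap big_ord0 mulr1.
  have sm i : smooth1 (bump_fam (c M) k i) by exact: bump_smooth.
  have := tspan_lin (-1) (tspan_mul sm IH) IH.
  congr tspan; apply/funext => x; rewrite /gap big_ord_recr/= -/(gap k M x) -/(bumpn (c M) k x).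
  by ring.
have := tspan_lin (- 2) (H k) (tspan_tensor (@bumpn_supp (a, b) k)).
by congr tspan; apply/funext => x; rewrite /approx_sign -/(bumpn (a, b) k x); ring.
Qed.

Lemma approx_sign_le1 a b k x : `|approx_sign a b k x| <= 1.
Proof.
rewrite normrM mulr_ile1//; last first.
  by have /andP[p q] := bumpn_01 (a, b) k x; rewrite ger0_norm.
by have /andP[p q] := gap_01 k k x; rewrite ler_norml; lra.
Qed.

Lemma approx_sign_cvg a b x : obox a b x -> approx_sign a b k x @[k --> \oo] -->
  (1 - 2 * \1_(~` \bigcup_m obox (c m).1 (c m).2) x : R).
Proof.
move=> abx; rewrite -[X in _ --> X]mulr1; apply: cvgM; last exact: bumpn_cvg.
apply: cvgB; first exact: cvg_cst.
apply: cvgMr; rewrite indicE.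
have [xU|xU] := pselect ((\bigcup_m obox (c m).1 (c m).2) x).
  by rewrite memNset//=; exact: gap_cvg.
rewrite mem_set//= (_ : (fun k => _) = cst 1); first exact: cvg_cst.
by apply/funext => k; rewrite gap_out.
Qed.

End box_cover.

(** The L1 norm is the pairing of f with its sign. Boxes covering {f > 0} with little excess
    measure, supplied by the definition of [leb], make the approximate signs converge to that sign
    outside a small set. *)
Lemma le_Rintegral_duality a b (f : T -> R) (K : R) :
  mu.-integrable (obox a b) (EFin \o f) ->
  (forall psi, tspan (tensor_supp a b) psi -> (forall x, `|psi x| <= 1) ->
    (\int[mu]_(x in obox a b) (f x * psi x) <= K)%R) ->
  (\int[mu]_(x in obox a b) `|f x| <= K)%R.
Proof.
set Q : set T := obox a b => fi HK.
have mQ : measurable Q by exact: measurable_obox.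
have mf : measurable_fun Q f by move/measurable_int : fi => /measurable_EFinP.
have fQi : mu.-integrable setT (EFin \o (f \_ Q)).
  rewrite -restrict_EFin; apply/integrable_restrict => //.
  by rewrite setTI.
apply/ler_addgt0Pr => e e0.
have e20 : 0 < e / 2 by rewrite divr_gt0.
(* By absolute continuity, sets of measure below [dl] carry less than e/2 of the integral of |f|;
   the cover may therefore exceed {f > 0} by dl/2. *)
have [dl [dl0 Hdl]] := integral_normr_continuous fQi e20.
pose S : set T := Q `&` [set x | 0 < f x].
have mS : measurable S.
  have := mf mQ _ (measurable_itv `]0, +oo[%O); congr measurable.
  by apply/seteqP; split => x /=; rewrite in_itv/= andbT.
have Sfin : (leb S < +oo)%E by apply: le_lt_trans (obox_fin a b); apply: leb_mono => x [].
have dl20 : 0 < dl / 2 by rewrite divr_gt0.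
have [c Sc cS] := leb_adherent dl20 Sfin.
(* U covers {f > 0} up to measure zero with little excess, so s below is sgn f off the small set N. *)
pose U : set T := \bigcup_m obox (c m).1 (c m).2.
pose B : set T := \bigcup_m box (c m).1 (c m).2.
have mU : measurable U by apply: bigcupT_measurable => m; exact: measurable_obox.
have mB : measurable B by apply: bigcupT_measurable => m; exact: measurable_box.
have Bc : (mu B <= mu S + (dl / 2)%:E)%E.
  apply: le_trans cS; apply: (le_trans (leb_sigma_subadditive _)).
  by apply: lee_nneseries => [m _ _|m _]; [exact: leb_ge0|rewrite leb_box].
have BU0 : mu (B `\` U) = 0%E.
  apply/eqP; rewrite eq_le measure_ge0 andbT.
  rewrite -(@leb_null_bigcup R n (fun m => box (c m).1 (c m).2 `\` obox (c m).1 (c m).2)).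
    apply: leb_mono => x [[m _ xm] xU]; exists m => //; split => // xo.
    by apply: xU; exists m.
  by move=> m; exact: leb_box_obox.
have BS : (mu (B `\` S) <= (dl / 2)%:E)%E.
  have := measureDI mu mB mS; rewrite (setIidr Sc) => H.
  rewrite -(@leeD2lE _ (mu S)) ?ge0_fin_numE//.
  by rewrite addeC -H.
pose N : set T := (B `\` S) `|` (B `\` U).
have mN : measurable N by apply: measurableU; exact: measurableD.
have Ndl : (mu N < dl%:E)%E.
  apply: (@le_lt_trans _ _ (dl / 2)%:E); last by rewrite lte_fin ltr_pdivrMr// ltr_pMr// ltr1n.
  apply: (le_trans (measureU2 mu _ _)); try exact: measurableD.
  by rewrite [X in (_ + X)%E]BU0 adde0.
have Nint := Hdl _ mN Ndl.
pose s (x : T) : R := 1 - 2 * \1_(~` U) x.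
have ms : measurable_fun setT s.
  have m1 : measurable_fun setT (\1_(~` U) : T -> R) by apply: measurable_indic; exact: measurableC.
  have m2 := measurableT_comp (@mulrl_measurable R setT 2) m1.
  exact: (measurable_funB (measurable_cst (1 : R)) m2).
have sle (x : T) : `|s x| <= 1.
  rewrite /s indicE; case: (x \in _) => /=; rewrite ?mulr1 ?mulr0 ?subr0 ?normr1//.
  by rewrite (_ : 1 - 2 = -1) ?normrN1//; ring.
have fsK : (\int[mu]_(x in Q) (f x * s x) <= K)%R.
  have cv := cvg_Rintegral_bounded (M := 1) mQ fi
    (fun k => measurable_funTS (tspan_measurable (approx_sign_tspan c a b k)))
    (measurable_funTS ms) (fun k x _ => approx_sign_le1 c a b k x)
    (fun x Qx => @approx_sign_cvg c a b x Qx).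
  move/cvg_lim : (cv) => <- //; apply: limr_le.
    by apply/cvg_ex; eexists; exact: cv.
  by apply: nearW => k; apply: HK; [exact: approx_sign_tspan|exact: approx_sign_le1].
have ifs : mu.-integrable Q (EFin \o (fun x => f x * s x)).
  exact: (integrableMbounded mQ fi (measurable_funTS ms) (fun x _ => sle x)).
have iaf := integrable_norm fi.
have iN : mu.-integrable Q (EFin \o (fun x => `|f x| * \1_N x)).
  have m1 : measurable_fun Q (\1_N : T -> R) by exact: measurable_indic.
  apply: (integrableMbounded mQ iaf m1 (M := 1)) => x _.
  by rewrite indicE; case: (_ \in _); rewrite ?normr1 ?normr0.
have NE : (\int[mu]_(x in Q) (`|f x| * \1_N x) = \int[mu]_(x in N) `|(f \_ Q) x|)%R.
  rewrite Rintegral_mkcond [RHS]Rintegral_mkcond; apply: eq_Rintegral => x _.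
  rewrite !patchE indicE; case: (x \in Q); case: (x \in N) => /=;
    by rewrite ?mulr1 ?mulr0 ?normr0.
(* Off [N], f s = |f|; on [N], f s >= -|f|, and the added 2|f| makes up for it at a total cost of at
   most e. *)
apply: (@le_trans _ _ (\int[mu]_(x in Q) (f x * s x + 2 * (`|f x| * \1_N x)))%R).
  apply: le_Rintegral => //.
    exact: (integrableD mQ ifs (integrableZl mQ 2 iN)).
  move=> x Qx; rewrite /s !indicE.
  have [fx|fx] := ltP 0 (f x).
    have Sx : S x by split.
    have Bx : B x by exact: Sc.
    have [xU|xU] := pselect (U x).
      rewrite memNset//= mulr0 subr0 mulr1 gtr0_norm// lerDl.
      by rewrite mulr_ge0// mulr_ge0// ltW.
    rewrite mem_set//= mulr1 gtr0_norm// (@mem_set _ N); last by right.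
    by rewrite mulr1; lra.
  have xS : ~ S x by case=> _ /=; rewrite ltNge fx.
  rewrite ler0_norm//; have [xU|xU] := pselect (U x).
    have Bx : B x.
      case: xU => m _ xm; exists m => // i.
      by have /andP[/ltW -> /ltW ->] := xm i.
    rewrite memNset//= mulr0 subr0 mulr1 (@mem_set _ N); last by left.
    by rewrite mulr1; lra.
  rewrite mem_set//= mulr1 (_ : 1 - 2 = -1); last by ring.
  by rewrite mulrN1 lerDl mulr_ge0// mulr_ge0// oppr_ge0.
rewrite RintegralD//; last exact: (integrableZl mQ 2 iN).
rewrite RintegralZl// NE; apply: lerD => //.
by rewrite -ler_pdivlMl// mulrC ltW.
Qed.

End duality.

Section cubes.
Context {R : realType} {n : nat}.
Local Notation V := 'rV[R]_n.+1.
Local Notation T := (lebT R n).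
Local Notation mu := (@lebm R n).
Implicit Types (p : V) (r : R).

Lemma leb_obox (a b : V) : leb (obox a b) = (boxvol a b)%:E.
Proof.
rewrite -leb_box; apply/eqP; rewrite eq_le; apply/andP; split.
  by apply: leb_mono => x xab i; have /andP[/ltW -> /ltW ->] := xab i.
have sub : box a b `<=` obox a b `|` (box a b `\` obox a b).
  by move=> x xab; have [?|?] := pselect (obox a b x); [left|right].
apply: (le_trans (leb_mono sub)).
apply: (le_trans (outer_measureU2 (@leb R n.+1) _ _)).
by rewrite [X in (_ + X)%E](leb_box_obox a b) adde0.
Qed.

(** For r > 0 this is the ball of the supremum norm, the metric ball of row vectors; its side is
    2r. *)
Definition cube p r : set V := obox (p - const_mx r) (p + const_mx r).

Lemma measurable_cube p r : measurable (cube p r : set T).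
Proof. exact: measurable_obox. Qed.

Lemma cubeP p r x : cube p r x <-> forall i, `|x ord0 i - p ord0 i| < r.
Proof.
by split=> H i; have := H i; rewrite !mxE ltr_norml => /andP[h1 h2];
  apply/andP; split; lra.
Qed.

Lemma leb_cube p r : 0 <= r -> leb (cube p r) = ((2 * r) ^+ n.+1)%:E.
Proof.
move=> r0; rewrite leb_obox; congr EFin.
rewrite /boxvol (eq_bigr (fun=> 2 * r)); first by rewrite prodr_const card_ord.
move=> i _; rewrite !mxE max_l; first by ring.
by rewrite (_ : _ - _ = 2 * r) ?mulr_ge0//; ring.
Qed.

Lemma lebm_cube p r : 0 <= r -> mu (cube p r) = ((2 * r) ^+ n.+1)%:E.
Proof. exact: leb_cube. Qed.

Lemma ball_cube p r : 0 < r -> ball p r = cube p r.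
Proof.
move=> r0; apply/seteqP; split => x.
  by case=> _ px; apply/cubeP => i; have := px ord0 i; rewrite /ball/= distrC.
move/cubeP => px; split => // i j; rewrite ord1.
by have := px j; rewrite /ball/= distrC.
Qed.

Lemma sub_cube p r s : r <= s -> cube p r `<=` cube p s.
Proof. by move=> rs x /cubeP px; apply/cubeP => i; exact: lt_le_trans (px i) rs. Qed.

Lemma box_sub_cube p r s : r < s ->
  box (p - const_mx r) (p + const_mx r) `<=` cube p s.
Proof.
move=> rs x px i; have := px i; rewrite !mxE => /andP[h1 h2].
by apply/andP; split; lra.
Qed.

End cubes.

Section poincare.
Context {R : realType} {n : nat}.
Local Notation V := 'rV[R]_n.+1.
Local Notation T := (lebT R n).
Local Notation mu := (@lebm R n).

Lemma Rintegral_positive (D : set T) (f : T -> R) : measurable D -> (0 < mu D)%E ->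
  mu.-integrable D (EFin \o f) -> (forall x, D x -> 0 < f x) ->
  (0 < \int[mu]_(x in D) f x)%R.
Proof.
move=> mD D0 fi f0; rewrite lt_neqAle Rintegral_ge0 ?andbT; last by move=> x /f0/ltW.
apply/eqP => If0.
have mf := measurable_int _ fi.
have : (\int[mu]_(x in D) `|(EFin \o f) x| = 0)%E.
  transitivity (\int[mu]_(x in D) (EFin \o f) x)%E.
    by apply: eq_integral => x /set_mem/f0/ltW fx; rewrite /= ger0_norm.
  by rewrite -(fineK (integrable_fin_num mD fi)) -[fine _]/(Rintegral mu D f) -If0.
move/(ae_eq_integral_abs mu mD mf) => [N [mN N0 DN]].
have : (mu D <= mu N)%E.
  apply: le_measure; rewrite ?inE// => x Dx; apply: DN => /= /(_ Dx)[] fx.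
  by have := f0 _ Dx; rewrite fx ltxx.
by rewrite N0 leNgt D0.
Qed.

Lemma weak_partial_tensor (Om : set V) (g h : V -> R) (a b : V) j u v :
  measurable (Om : set T) -> measurable_fun (Om : set T) (g : T -> R) ->
  measurable_fun (Om : set T) (h : T -> R) ->
  weak_partial Om j g h -> box a b `<=` Om -> tensor_supp a b u ->
  (forall t : R, is_derive t 1 (u j) (v t)) -> smooth_supp (a ord0 j) (b ord0 j) v ->
  (\int[mu]_(x in obox a b) (g x * tensor (upd u j v) x) =
   - \int[mu]_(x in obox a b) (h x * tensor u x))%R.
Proof.
move=> mOm mg mh W abOm su dv sv.
have suv := tensor_supp_upd su sv.
have sub : obox a b `<=` Om.
  by move=> x xab; apply: abOm => i; have /andP[/ltW -> /ltW ->] := xab i.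
have E (f : V -> R) w : tensor_supp a b w -> measurable_fun (Om : set T) (f : T -> R) ->
    fine (sint Om (fun x => f x * tensor w x)) =
    (\int[mu]_(x in obox a b) (f x * tensor w x))%R.
  move=> sw mf.
  have mfw := measurable_funM mf (measurable_funTS (measurable_tensor sw)).
  rewrite (sint_integral mOm mfw).
  rewrite -[LHS]/(Rintegral mu Om (fun x => f x * tensor w x)).
  apply: Rintegral_supp => //; first exact: measurable_obox.
  by move=> x _ xab; rewrite (tensor_supp_out sw)// mulr0.
have := W _ (tensor_test_fun su abOm).
rewrite (partial_tensor dv) => /(congr1 fine).
by rewrite fineN (E g _ suv mg) (E h _ su mh).
Qed.

(** The constant [c] is the mean of g weighted by a bump, so that g - c is orthogonal to the bump
    and [oscillation_pairing] applies. Rescaling one fixed bump makes [C] independent of the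
    cube. *)
Lemma poincare_cube : exists2 C : R, 0 < C &
  forall (Om : set V) (g : V -> R) (h : 'I_n.+1 -> V -> R) (p : V) (r : R),
    measurable (Om : set T) -> measurable_fun (Om : set T) (g : T -> R) ->
    (forall j, measurable_fun (Om : set T) (h j : T -> R)) ->
    (forall j, weak_partial Om j g (h j)) -> 0 < r ->
    box (p - const_mx r) (p + const_mx r) `<=` Om ->
    mu.-integrable (cube p r) (EFin \o (g : T -> R)) ->
    (forall j, mu.-integrable (cube p r) (EFin \o (h j : T -> R))) ->
    exists c, (\int[mu]_(x in cube p r) `|g x - c| <=
       C * r * \sum_(j < n.+1) \int[mu]_(x in cube p r) `|h j x|)%R.
Proof.
have [th0 [Th0 [sth0 dTh0 th0_gt0 Th00 Th01]]] := @unit_bump R.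
have [M M0 thM] := smooth_supp_bounded sth0.
(* Adding 1 ensures 1 <= 2 kappa whatever the bound [M]. *)
pose kappa := M + 1.
exists (2 * (1 + 2 * kappa) * (2 * kappa) ^+ n.+1).
  by rewrite !mulr_gt0// ?exprn_gt0// /kappa; lra.
move=> Om g h p r mOm mg mh W r0 pOm ig ih.
pose a := p - const_mx r; pose b := p + const_mx r.
have rV : 0 < r^-1 by rewrite invr_gt0.
(* The affine map t -> t/r + e i carries the side (p_i - r, p_i + r) to (-1, 1); the factor 1/r in
   [th] keeps its mass equal to 1. *)
pose e (i : 'I_n.+1) : R := - (r^-1 * p ord0 i).
have aE i : a ord0 i = p ord0 i - r by rewrite !mxE.
have bE i : b ord0 i = p ord0 i + r by rewrite !mxE.
have aff i t : r^-1 * t + e i = r^-1 * (t - p ord0 i) by rewrite /e; ring.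
pose th (i : 'I_n.+1) (t : R) := r^-1 * th0 (r^-1 * t + e i).
pose Th (i : 'I_n.+1) (t : R) := Th0 (r^-1 * t + e i).
have sth : tensor_supp a b th.
  move=> i; split; first by apply: smooth1Z; apply: smooth1_affine sth0.1.
  move=> t; rewrite aE bE /th => tab; rewrite sth0.2 ?mulr0// aff.
  apply: contra tab => /andP[h1 h2].
  move: h1 h2; rewrite -[_ * (_ - _)]mulrC ltr_pdivlMr// ltr_pdivrMr// => h1 h2.
  by apply/andP; split; lra.
have dTh i (t : R) : is_derive t 1 (Th i) (th i t) by exact: is_derive_affine.
have Tha i t : t <= a ord0 i -> Th i t = 0.
  by rewrite aE => ta; rewrite /Th Th00// aff mulrC ler_pdivrMr//; lra.
have Thb i t : b ord0 i <= t -> Th i t = 1.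
  by rewrite bE => ta; rewrite /Th Th01// aff mulrC ler_pdivlMr//; lra.
have ab i : a ord0 i <= b ord0 i by rewrite aE bE; lra.
have kappa1 : 1 <= 2 * kappa by rewrite /kappa; lra.
have abr i : b ord0 i - a ord0 i = 2 * r by rewrite aE bE; ring.
have thK i t : `|th i t| <= kappa / r.
  rewrite /th normrM (gtr0_norm rV) mulrC ler_wpM2r ?(ltW rV)//.
  by rewrite (le_trans (thM _))// /kappa; lra.
have Qfin : (mu (cube p r) < +oo)%E by exact: obox_fin.
have mQ := @measurable_cube _ _ p r.
have i1 : mu.-integrable (cube p r) (EFin \o (cst 1 : T -> R)).
  apply: measurable_bounded_integrable => //.
  by exists 1; split => // s s1 x _ /=; rewrite normr1 ltW.
have ith : mu.-integrable (cube p r) (EFin \o (tensor th : T -> R)).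
  have := integrable_tspan i1 (tspan_tensor sth).
  by congr integrable; apply/funext => x /=; rewrite mul1r.
have Dgt0 : (0 < \int[mu]_(x in cube p r) tensor th x)%R.
  apply: Rintegral_positive => //.
    by rewrite lebm_cube ?(ltW r0)// lte_fin exprn_gt0// mulr_gt0.
  move=> x /cubeP xQ; apply: prodr_gt0 => i _; rewrite /th mulr_gt0// th0_gt0//.
  rewrite aff mulrC ltr_pdivlMr// ltr_pdivrMr// mulN1r mul1r -ltr_norml.
  exact: xQ.
set D := (\int[mu]_(x in cube p r) tensor th x)%R in Dgt0.
pose c := (\int[mu]_(x in cube p r) (g x * tensor th x))%R / D.
exists c.
have igc : mu.-integrable (cube p r) (EFin \o (fun x : T => g x - c)).
  have -> : EFin \o (fun x : T => g x - c) =
      ((EFin \o g) \- (fun x : T => c%:E * (EFin \o (cst 1%R : T -> R)) x))%E.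
    by apply/funext => x /=; rewrite mulr1.
  exact: (integrableB mQ ig (integrableZl mQ c i1)).
(* Subtracting [c] preserves the weak derivatives because derivatives of supported products have
   integral 0. *)
have Wc j u v : tensor_supp a b u ->
  (forall t : R, is_derive t 1 (u j) (v t)) -> smooth_supp (a ord0 j) (b ord0 j) v ->
  (\int[mu]_(x in obox a b) ((g x - c) * tensor (upd u j v) x) =
   - \int[mu]_(x in obox a b) (h j x * tensor u x))%R.
  move=> su dv sv; rewrite -(weak_partial_tensor mOm mg (mh j) (W j) pOm su dv sv).
  have suv := tensor_supp_upd su sv.
  have i2 := integrable_tspan ig (tspan_tensor suv).
  have i3 := integrable_tspan i1 (tspan_tensor suv).
  transitivity (\int[mu]_(x in cube p r)
     (g x * tensor (upd u j v) x - c * (1 * tensor (upd u j v) x)))%R.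
    by apply: eq_Rintegral => x _; ring.
  rewrite RintegralB//; last exact: (integrableZl mQ c i3).
  rewrite RintegralZl// [X in _ - _ * X](_ : _ = 0) ?mulr0 ?subr0//.
  rewrite -[RHS](Rintegral_partial_tensor su dv sv).
  rewrite [RHS](@Rintegral_supp _ _ _ mu (cube p r))//.
    by apply: eq_Rintegral => x _; rewrite mul1r.
  by move=> x _ xQ; rewrite (tensor_supp_out suv).
have g0 : (\int[mu]_(x in obox a b) ((g x - c) * tensor th x) = 0)%R.
  have i2 := integrable_tspan ig (tspan_tensor sth).
  transitivity (\int[mu]_(x in cube p r) (g x * tensor th x - c * tensor th x))%R.
    by apply: eq_Rintegral => x _; ring.
  rewrite RintegralB//; last exact: (integrableZl mQ c ith).
  by rewrite RintegralZl// -/D /c divfK ?subrr// gt_eqF.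
apply: le_Rintegral_duality => // psi Spsi psi1.
apply: (le_trans (ler_norm _)).
have := @oscillation_pairing _ _ a b th Th ab sth dTh Tha Thb (fun x => g x - c) h
  igc ih Wc r kappa r0 kappa1 abr thK psi g0 Spsi psi1.
by congr (_ <= _); ring.
Qed.

End poincare.

(** * Decay of the oscillation at a zero *)

Section powers.
Context {R : realType}.

(** Beyond lam the ratio t/lam is at least 1, hence at most its power of exponent b >= 1. The free
    parameter lam is later tuned to the scale of the cube. *)
Lemma le_young_power (lam t b : R) : 0 < lam -> 1 <= b -> 0 <= t ->
  t <= lam + lam / lam `^ b * t `^ b.
Proof.
move=> l0 b1 t0; have lb0 : 0 < lam `^ b by exact: powR_gt0.
have [tl|lt] := leP t lam.
  by rewrite (le_trans tl)// lerDl !mulr_ge0 ?invr_ge0 ?powR_ge0// ltW.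
have tl1 : 1 <= t / lam by rewrite ler_pdivlMr// mul1r ltW.
have tE : t `^ b = (t / lam) `^ b * lam `^ b.
  by rewrite -powRM ?divfK ?gt_eqF// ?divr_ge0// ltW.
have : t / lam <= (t / lam) `^ b.
  by rewrite -[leLHS]powRr1 ?(le_trans ler01)//; exact: ler_powR.
rewrite ler_pdivrMr// => /le_trans; apply.
rewrite tE mulrA (_ : lam / lam `^ b * (t / lam) `^ b * lam `^ b = (t / lam) `^ b * lam).
  by rewrite lerDr ltW.
by field; rewrite gt_eqF.
Qed.

Lemma le_one_power (t b : R) : 1 <= b -> 0 <= t -> t <= 1 + t `^ b.
Proof.
by move=> b1 t0; have := le_young_power ltr01 b1 t0; rewrite powR1 divr1 mul1r.
Qed.

End powers.

Section balls.
Context {R : realType} {n : nat}.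
Local Notation V := 'rV[R]_n.+1.
Local Notation T := (lebT R n).
Local Notation mu := (@lebm R n).

Lemma le_coord_enorm (z : V) i : `|z ord0 i| <= enorm z.
Proof.
rewrite -sqrtr_sqr ler_wsqrtr// (bigD1 i)//= lerDl.
by apply: sumr_ge0 => j _; exact: sqr_ge0.
Qed.

Lemma enorm_le (z : V) (s : R) : (forall i, `|z ord0 i| <= s) ->
  enorm z <= n.+1%:R * s.
Proof.
move=> zs; have s0 : 0 <= s by exact: le_trans (zs ord0).
have Ns0 : 0 <= n.+1%:R * s by rewrite mulr_ge0.
rewrite -(ger0_norm Ns0) -sqrtr_sqr ler_wsqrtr// exprMn.
apply: (@le_trans _ _ (\sum_(i < n.+1) s ^+ 2)).
  apply: ler_sum => i _; rewrite -real_normK ?num_real//.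
  by rewrite ler_sqr ?nnegrE.
rewrite sumr_const card_ord -[leLHS]mulr_natl ler_wpM2r ?sqr_ge0//.
by rewrite expr2 ler_peMl// ler1n.
Qed.

Lemma eball_cube (x : V) r : eball x r `<=` cube x r.
Proof.
move=> y xy; apply/cubeP => i; apply: le_lt_trans xy.
by have := le_coord_enorm (y - x) i; rewrite !mxE.
Qed.

(** Coordinates bounded by s give Euclidean norm at most (n+1)s; the extra 2 in the denominator
    makes the inequality strict. *)
Lemma cube_eball (x : V) r : 0 < r -> cube x (r / (2 * n.+1%:R)) `<=` eball x r.
Proof.
move=> r0 y /cubeP xy; rewrite /eball/=.
apply: (@le_lt_trans _ _ (n.+1%:R * (r / (2 * n.+1%:R)))).
  by apply: enorm_le => i; rewrite !mxE ltW.
have N0 : n.+1%:R != 0 :> R by rewrite pnatr_eq0.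
rewrite (_ : _ * _ = r / 2); last by move: (n.+1%:R : R) N0 => N N0; field.
by rewrite ltr_pdivrMr// ltr_pMr// ltr1n.
Qed.

Lemma measurable_eball (x : V) r : measurable (eball x r : set T).
Proof.
have m1 : measurable_fun setT (fun y : T => \sum_(i < n.+1) ((y : V) ord0 i - x ord0 i) ^+ 2 : R).
  apply: measurable_sum => i; apply: measurable_funX.
  exact: (measurable_funB (measurable_coord i) (measurable_cst (x ord0 i))).
have m2 : measurable_fun setT (Num.sqrt : R -> R).
  by apply: continuous_measurable_fun; exact: sqrt_continuous.
have := measurableT_comp m2 m1 measurableT (measurable_itv `]-oo, r[%O).
rewrite setTI; congr measurable; apply/seteqP.
have E (y : V) : enorm (y - x) = Num.sqrt (\sum_(i < n.+1) (y ord0 i - x ord0 i) ^+ 2).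
  by rewrite /enorm; congr Num.sqrt; apply: eq_bigr => i _; rewrite !mxE.
by split => y /=; rewrite in_itv/= /eball/= E.
Qed.

End balls.

Section telescoping.
Context {R : realType}.

(** The increments K s^gam at s = r/2^k form a geometric series of ratio 2^-gam < 1, and the limit
    at 0 disposes of the remaining term. *)
Lemma halving_decay (m : R -> R) (K gam rho r : R) : 0 <= K -> 0 < gam ->
  m s @[s --> 0^'+] --> (0 : R) ->
  (forall s, 0 < s <= rho -> `|m s - m (s / 2)| <= K * s `^ gam) ->
  0 < r <= rho -> `|m r| <= K / (1 - 2 `^ (- gam)) * r `^ gam.
Proof.
move=> K0 gam0 m0 mK /andP[r0 rrho].
pose q : R := 2 `^ (- gam).
have q1 : q < 1.
  rewrite /q powRN invf_lt1 ?powR_gt0//.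
  have : 1 `^ gam < 2 `^ gam by apply: gt0_ltr_powR; rewrite ?nnegrE// ltr1n.
  by rewrite powR1.
have q1' : 0 < 1 - q by rewrite subr_gt0.
set A := K / (1 - q).
have A0 : 0 <= A by rewrite divr_ge0// ltW.
have half s : 0 < s -> (s / 2) `^ gam = s `^ gam * q.
  by move=> s0; rewrite powRM ?(ltW s0)// -powR_inv1// -powRrM mulN1r.
(* With A = K/(1 - 2^-gam) one has A (s^gam - (s/2)^gam) = K s^gam, so each halving consumes exactly
   one increment of this bound. *)
have step k : `|m r| <= `|m (r / 2 ^+ k)| + A * (r `^ gam - (r / 2 ^+ k) `^ gam).
  elim: k => [|k IH]; first by rewrite expr0 divr1 subrr mulr0 addr0.
  apply: (le_trans IH); set s := r / 2 ^+ k.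
  have s0 : 0 < s by rewrite divr_gt0// exprn_gt0.
  have srho : s <= rho.
    apply: le_trans rrho; rewrite ler_pdivrMr ?exprn_gt0// ler_peMr ?(ltW r0)//.
    by rewrite exprn_ege1// ler1n.
  have -> : r / 2 ^+ k.+1 = s / 2 by rewrite exprSr invfM mulrA.
  rewrite half//.
  have H : `|m s| <= `|m (s / 2)| + K * s `^ gam.
    have := mK s; rewrite s0 srho => /(_ isT) H.
    by have := ler_normD (m s - m (s / 2)) (m (s / 2)); rewrite subrK; lra.
  have KE : K * s `^ gam = A * (s `^ gam - s `^ gam * q).
    by rewrite /A; field; rewrite gt_eqF.
  by move: H; rewrite KE; lra.
apply/ler_addgt0Pr => e e0.
have /cvgr0Pnorm_le/(_ e e0) := m0.
move=> [dl /= dl0 Hdl].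
have [k rk] : exists k, r / 2 ^+ k < dl.
  exists (Num.truncn (r / dl)).+1.
  rewrite ltr_pdivrMr ?exprn_gt0// mulrC -ltr_pdivrMr//.
  apply: (lt_le_trans (truncnS_gt _)); rewrite -natrX ler_nat.
  by rewrite ltnW// ltn_expl.
have rk0 : 0 < r / 2 ^+ k by rewrite divr_gt0// exprn_gt0.
apply: (le_trans (step k)); rewrite addrC; apply: lerD.
  by rewrite ler_wpM2l// gerBl powR_ge0.
apply: Hdl => //=.
by rewrite sub0r normrN gtr0_norm.
Qed.

End telescoping.

Section local_estimates.
Context {R : realType} {n : nat}.
Local Notation V := 'rV[R]_n.+1.
Local Notation T := (lebT R n).
Local Notation mu := (@lebm R n).
Variables (Om : set V) (b : R).
Hypothesis b1 : 1 <= b.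
Hypothesis mOm : measurable (Om : set T).

Lemma integrable_power_sub (f : V -> R) (Q : set T) : measurable Q -> Q `<=` Om ->
  (mu Q < +oo)%E -> measurable_fun (Om : set T) (f : T -> R) ->
  mu.-integrable (Om : set T) (fun x : T => (`|f x| `^ b)%:E) ->
  mu.-integrable Q (EFin \o (f : T -> R)).
Proof.
move=> mQ QOm Qfin mf fb.
have i1 : mu.-integrable Q (EFin \o (cst 1 : T -> R)).
  apply: measurable_bounded_integrable => //.
  by exists 1; split => // s s1 x _ /=; rewrite normr1 ltW.
have fbQ := integrableS mOm mQ QOm fb.
apply: (le_integrable mQ _ _ (integrableD mQ i1 fbQ)).
  by apply/measurable_EFinP; exact: measurable_funS mf.
move=> x Qx /=; rewrite lee_fin [leRHS]ger0_norm ?addr_ge0 ?powR_ge0//.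
exact: le_one_power.
Qed.

(* Young's inequality |f| <= lam + lam^(1-b) |f|^b, in place of Hölder's. *)
Lemma Rintegral_young (f : V -> R) (Q : set T) (lam E : R) : measurable Q -> Q `<=` Om ->
  (mu Q < +oo)%E -> measurable_fun (Om : set T) (f : T -> R) ->
  mu.-integrable (Om : set T) (fun x : T => (`|f x| `^ b)%:E) ->
  0 < lam -> (\int[mu]_(x in Q) (`|f x| `^ b) <= E)%R ->
  (\int[mu]_(x in Q) `|f x| <= lam * fine (mu Q) + lam / lam `^ b * E)%R.
Proof.
move=> mQ QOm Qfin mf fb lam0 fE.
have fi := integrable_power_sub mQ QOm Qfin mf fb.
have fbQ : mu.-integrable Q (EFin \o (fun x : T => `|f x| `^ b)).
  exact: integrableS fb.
have i1 : mu.-integrable Q (EFin \o (cst lam : T -> R)).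
  apply: measurable_bounded_integrable => //.
  by exists lam; split => // [|s s1 x _ /=]; rewrite ?num_real// gtr0_norm// ltW.
have i2 := integrableZl mQ (lam / lam `^ b) fbQ.
apply: (@le_trans _ _ (\int[mu]_(x in Q) (lam + lam / lam `^ b * `|f x| `^ b))%R).
  apply: (le_Rintegral mQ (integrable_norm fi) (integrableD mQ i1 i2)) => x _.
  exact: (le_young_power lam0 b1 (normr_ge0 (f x))).
rewrite RintegralD// Rintegral_cst// RintegralZl//.
by rewrite lerD2l ler_wpM2l// divr_ge0 ?powR_ge0// ltW.
Qed.

(** One [c] serves all radii from r/2 to r, so the averages at r and r/2 are compared through it.
    The factor is the inverse of a lower bound for the volume of the ball, which contains a cube of
    radius s/(2(n+1)). *)
Lemma ball_avg_close (g : V -> R) (x : V) (r s c : R) :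
  cube x r `<=` Om -> measurable_fun (Om : set T) (g : T -> R) ->
  mu.-integrable (cube x r) (EFin \o (g : T -> R)) ->
  0 < r -> r / 2 <= s <= r ->
  `|ball_avg g x s - c| <= (2 * n.+1%:R / r) ^+ n.+1 * (\int[mu]_(y in cube x r) `|(g y - c)%R|)%R.
Proof.
move=> QOm mg ig r0 /andP[rs sr].
have s0 : 0 < s by lra.
have mB := @measurable_eball _ _ x s.
have mQ := @measurable_cube _ _ x r.
have BQ : eball x s `<=` cube x r by apply: (subset_trans (@eball_cube _ _ x s)); exact: sub_cube.
have BOm := subset_trans BQ QOm.
have Qfin : (mu (cube x r) < +oo)%E by exact: obox_fin.
have igB := integrableS mQ mB BQ ig.
have i1Q : mu.-integrable (cube x r) (EFin \o (cst c : T -> R)).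
  apply: measurable_bounded_integrable => //.
  by exists `|c|; split => // t t1 y _ /=; rewrite ltW.
have i1 := integrableS mQ mB BQ i1Q.
set L := fine (leb (eball x s)).
have N0 : 0 < n.+1%:R :> R by rewrite ltr0n.
have Bfin : mu (eball x s) \is a fin_num.
  by rewrite ge0_fin_numE//; apply: le_lt_trans Qfin; apply: leb_mono.
have LE : (r / (2 * n.+1%:R)) ^+ n.+1 <= L.
  rewrite -lee_fin /L fineK//.
  apply: (@le_trans _ _ (leb (cube x (s / (2 * n.+1%:R))))).
    rewrite leb_cube ?divr_ge0 ?mulr_ge0 ?(ltW s0)// lee_fin lerXn2r ?nnegrE//.
    - by rewrite divr_ge0 ?mulr_ge0 ?(ltW r0).
    - by rewrite mulr_ge0 ?divr_ge0 ?mulr_ge0 ?(ltW s0).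
    rewrite (_ : 2 * (s / (2 * n.+1%:R)) = 2 * s / (2 * n.+1%:R)); last by rewrite mulrA.
    by rewrite ler_wpM2r ?invr_ge0 ?mulr_ge0//; lra.
  by apply: leb_mono; exact: cube_eball.
have c0 : 0 < (r / (2 * n.+1%:R)) ^+ n.+1 by rewrite exprn_gt0// divr_gt0// mulr_gt0.
have L0 : 0 < L by exact: lt_le_trans LE.
rewrite /ball_avg -/L.
rewrite (sint_integral mB (measurable_funS mOm BOm mg)).
rewrite -[fine _]/(Rintegral mu (eball x s) g).
have -> : (Rintegral mu (eball x s) g / L - c = (\int[mu]_(y in eball x s) (g y - c)) / L)%R.
  rewrite RintegralB// Rintegral_cst// -[fine _]/L; field.
  by rewrite gt_eqF.
have igc := integrableB mQ ig i1Q.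
have igcB := integrableB mB igB i1.
rewrite normrM normfV (gtr0_norm L0) mulrC.
apply: ler_pM => //.
- by rewrite invr_ge0 ltW.
- have -> : (2 * n.+1%:R / r) ^+ n.+1 = ((r / (2 * n.+1%:R)) ^+ n.+1)^-1.
    by rewrite -exprVn invf_div.
  by rewrite lef_pV2 ?posrE.
apply: (le_trans (le_normr_Rintegral mB igcB)).
rewrite /Rintegral fine_le//.
- exact: (integrable_fin_num mB (integrable_norm igcB)).
- exact: (integrable_fin_num mQ (integrable_norm igc)).
apply: ge0_subset_integral => //.
by case/integrableP : (integrable_norm igc).
Qed.

End local_estimates.

(** * Energy of cubes centred at a zero *)

Section energy.
Context {R : realType} {n : nat}.
Local Notation V := 'rV[R]_n.+1.
Local Notation T := (lebT R n).
Local Notation mu := (@lebm R n).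
Local Notation N := (n.+1).
Variables (Om : set V) (g : V -> R) (h : 'I_n.+1 -> V -> R) (d a b : R).

(** The real power of 0 with exponent -a is 0 by convention, so the infinite value at zeros of g is
    imposed by hand. *)
Definition inv_power (y : V) : \bar R :=
  if g y == 0 then +oo%E else (`|g y| `^ (- a))%:E.
Definition energy (y : V) : \bar R :=
  (\sum_(j < n.+1) (`|h j y| `^ b)%:E + inv_power y)%E.

Lemma inv_power_ge0 y : (0 <= inv_power y)%E.
Proof. by rewrite /inv_power; case: eqP => // _; rewrite lee_fin powR_ge0. Qed.

Lemma energy_ge0 y : (0 <= energy y)%E.
Proof.
apply: adde_ge0; last exact: inv_power_ge0.
by apply: sume_ge0 => j _; rewrite lee_fin powR_ge0.
Qed.

(** A linear form of Markov's inequality: 1 - |g|/M is at most the indicator of {|g| <= M}, where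
    |g|^-a >= M^-a. It can be integrated directly, without measuring a level set. *)
Lemma inv_power_lower (M : R) y : 0 < M -> 0 < a ->
  ((M `^ (- a) * (1 - `|g y| / M))%:E <= inv_power y)%E.
Proof.
move=> M0 a0; rewrite /inv_power; case: ifPn => [_|gy]; first exact: leey.
have g0 : 0 < `|g y| by rewrite normr_gt0.
rewrite lee_fin; have [gM|Mg] := leP `|g y| M.
  apply: (@le_trans _ _ (M `^ (- a))).
    by rewrite ler_piMr ?powR_ge0// gerBl divr_ge0// ltW.
  rewrite !powRN lef_pV2 ?posrE ?powR_gt0//.
  by apply: ge0_ler_powR => //; rewrite ?nnegrE ltW.
apply: (@le_trans _ _ 0); last exact: powR_ge0.
rewrite mulr_ge0_le0 ?powR_ge0// subr_le0 ler_pdivlMr// mul1r.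
exact: ltW.
Qed.

Hypothesis oOm : open Om.
Hypothesis mOm : measurable (Om : set T).
Hypothesis mg : measurable_fun (Om : set T) (g : T -> R).
Hypothesis mh : forall j, measurable_fun (Om : set T) (h j : T -> R).
Hypothesis W : forall j, weak_partial Om j g (h j).
Hypothesis ig : mu.-integrable (Om : set T) (fun y : T => (`|g y| `^ b)%:E).
Hypothesis ih : forall j, mu.-integrable (Om : set T) (fun y : T => (`|h j y| `^ b)%:E).
Hypothesis iH : mu.-integrable (Om : set T) (energy : T -> \bar R).
Hypothesis iF : mu.-integrable (Om : set T) (inv_power : T -> \bar R).
Hypothesis b1 : 1 <= b.
Hypothesis a0 : 0 < a.
Hypothesis dN : d < N%:R.
Hypothesis abd : (1 - (N%:R - d) / b) * a >= N%:R - d.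

Local Notation m := (N%:R - d).
Local Notation gam := (1 - m / b).

Let m0 : 0 < m. Proof. by rewrite subr_gt0. Qed.
Let b0 : 0 < b. Proof. exact: lt_le_trans b1. Qed.
Let gam0 : 0 < gam.
Proof. by rewrite -(pmulr_lgt0 _ a0); exact: lt_le_trans abd. Qed.

(** The two smallness conditions on [eps] serve different ends: the one with [C1] and [C2] puts the
    Markov threshold [M] below rho^gam, and eps <= 1/4 contradicts the resulting mass of at least
    rho^d / 2. *)
Lemma energy_decay_contra (C1 C2 eps : R) : 0 <= C1 -> 0 <= C2 -> 0 < eps -> eps <= 1/4 ->
  2 * (C1 + 2 ^+ N * (C2 + 2 * C2 / (1 - 2 `^ (- gam))) + 1) * eps `^ b^-1 <= 1 ->
  forall x rho, 0 < rho <= 1 -> cube x rho `<=` Om ->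
  ball_avg g x r @[r --> 0^'+] --> (0 : R) ->
  (forall r, 0 < r <= rho -> exists c,
    (\int[mu]_(y in cube x r) `|(g y - c)%R| <= C1 * (eps `^ b^-1 * r `^ gam) * r ^+ N)%R /\
    (forall s, r / 2 <= s <= r -> `|ball_avg g x s - c| <= C2 * (eps `^ b^-1 * r `^ gam))) ->
  ~ (\int[mu]_(y in cube x rho) energy y <= (eps * rho `^ d)%:E)%E.
Proof.
move=> C10 C20 eps0 eps4; set e0 := eps `^ b^-1.
set C4 := 2 * C2 / (1 - 2 `^ (- gam)).
set C5 := C1 + _ + 1 => C5e x r /andP[r0 r1] QOm avg0 H HE.
have e00 : 0 < e0 by exact: powR_gt0.
have q1 : 2 `^ (- gam) < 1.
  rewrite powRN invf_lt1 ?powR_gt0//.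
  have : 1 `^ gam < 2 `^ gam by apply: gt0_ltr_powR; rewrite ?nnegrE// ltr1n.
  by rewrite powR1.
have C40 : 0 <= C4 by rewrite divr_ge0 ?mulr_ge0// subr_ge0 ltW.
have C50 : 0 < C5 by rewrite ltr_wpDl// addr_ge0// mulr_ge0 ?addr_ge0// exprn_ge0.
set e := e0 * r `^ gam.
have e_gt0 : 0 < e by rewrite mulr_gt0// powR_gt0.
have rN0 : 0 < r ^+ N by rewrite exprn_gt0.
have mr : `|ball_avg g x r| <= C4 * e.
  have K0 : 0 <= 2 * C2 * e0 by rewrite !mulr_ge0// ltW.
  have hK s : 0 < s <= r -> `|ball_avg g x s - ball_avg g x (s / 2)| <= 2 * C2 * e0 * s `^ gam.
    move=> /[dup] sr /andP[s0 _]; have [c [_ Hc]] := H s sr.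
    have h1 := Hc s; have h2 := Hc (s / 2).
    have {}h1 : `|ball_avg g x s - c| <= C2 * (e0 * s `^ gam) by apply: h1; lra.
    have {}h2 : `|ball_avg g x (s / 2) - c| <= C2 * (e0 * s `^ gam) by apply: h2; lra.
    have := ler_normB (ball_avg g x s - c) (ball_avg g x (s / 2) - c).
    rewrite opprB addrA subrK => /le_trans; apply.
    by apply: (le_trans (lerD h1 h2)); rewrite le_eqVlt; apply/orP; left; apply/eqP; ring.
  have rr : 0 < r <= r by rewrite r0 lexx.
  have := halving_decay K0 gam0 avg0 hK rr.
  by congr (_ <= _); rewrite /C4 /e; ring.
have rr : 0 < r <= r by rewrite r0 lexx.
have [c [Ic Hc]] := H r rr.
have mrc : `|ball_avg g x r - c| <= C2 * e by apply: Hc; lra.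
have cM : `|c| <= (C2 + C4) * e.
  have := ler_normB (ball_avg g x r) (ball_avg g x r - c).
  by rewrite opprB addrC subrK => /le_trans; apply; lra.
have mQ := @measurable_cube R n x r.
have Qfin : (mu (cube x r) < +oo)%E by exact: obox_fin.
have igQ := integrable_power_sub b1 mOm mQ QOm Qfin mg ig.
have icst (t : R) : mu.-integrable (cube x r) (EFin \o (cst t : T -> R)).
  apply: measurable_bounded_integrable => //.
  by exists `|t|; split => // s t1 y _ /=; rewrite ltW.
have igc : mu.-integrable (cube x r) (EFin \o (fun y : T => g y - c)).
  exact: (integrableB mQ igQ (icst c)).
have fQ : fine (mu (cube x r)) = (2 * r) ^+ N by rewrite lebm_cube// ltW.
have Ig : (\int[mu]_(y in cube x r) `|g y| <= (C5 - 1) * e * r ^+ N)%R.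
  apply: (@le_trans _ _ (\int[mu]_(y in cube x r) (`|(g y - c)%R| + `|c|))%R).
    apply: le_Rintegral => //.
    - exact: integrable_norm.
    - exact: (integrableD mQ (integrable_norm igc) (icst `|c|)).
    by move=> y _; have := ler_normD (g y - c) c; rewrite subrK.
  rewrite (RintegralD mQ (integrable_norm igc) (icst `|c|)).
  rewrite Rintegral_cst// fQ exprMn.
  have : `|c| * (2 ^+ N * r ^+ N) <= (C2 + C4) * e * (2 ^+ N * r ^+ N).
    by rewrite ler_wpM2r// mulr_ge0 ?exprn_ge0// ltW.
  move=> h1; apply: (le_trans (lerD Ic h1)).
  by rewrite le_eqVlt; apply/orP; left; apply/eqP; rewrite /C5 -/C4 /e; ring.
have C51 : 0 <= C5 - 1 by rewrite addrK addr_ge0// mulr_ge0 ?addr_ge0// exprn_ge0.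
(* At least twice the bound for the integral of |g| divided by r^N, so that the loss in
   [inv_power_lower] is at most r^N / 2, against a cube of volume at least r^N. *)
pose M := 2 * C5 * e.
have M0 : 0 < M by apply: mulr_gt0 => //; apply: mulr_gt0.
have IF : (\int[mu]_(y in cube x r) inv_power y <= (eps * r `^ d)%:E)%E.
  apply: le_trans HE; apply: le_integral => //.
  - exact: integrableS iF.
  - exact: integrableS iH.
  move=> y _; rewrite /energy leeDr//.
  by apply: sume_ge0 => j _; rewrite lee_fin powR_ge0.
have low : M `^ (- a) * (r ^+ N / 2) <= eps * r `^ d.
  rewrite -lee_fin; apply: le_trans IF.
  pose k (y : T) : R := M `^ (- a) * (1 - `|g y| / M).
  have i1 := integrable_norm igQ.
  have i2 := integrableZl mQ M^-1 i1.
  have i3 := integrableB mQ (icst 1) i2.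
  have ik : mu.-integrable (cube x r) (EFin \o k).
    have := integrableZl mQ (M `^ (- a)) i3.
    by congr integrable; apply/funext => y; rewrite /k /= [_^-1 * _]mulrC.
  apply: (@le_trans _ _ (\int[mu]_(y in cube x r) (k y)%:E)%E); last first.
    apply: le_integral => //; first exact: integrableS iF.
    by move=> y _; exact: inv_power_lower.
  rewrite -[leRHS]fineK; last exact: (integrable_fin_num mQ ik).
  rewrite lee_fin -[fine _]/(Rintegral mu (cube x r) k).
  have -> : (Rintegral mu (cube x r) k =
      M `^ (- a) * ((2 * r) ^+ N - M^-1 * \int[mu]_(y in cube x r) `|g y|))%R.
    have e1 := Rintegral_cst mu mQ 1; rewrite mul1r fQ in e1.
    have e2 := RintegralB mQ (icst 1) i2.
    have e3 := RintegralZl M^-1 mQ i1.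
    have e4 := RintegralZl (M `^ (- a)) mQ i3.
    rewrite -e1 -e3 -e2 -e4.
    by apply: eq_Rintegral => y _; rewrite /k /= [_^-1 * _]mulrC.
  apply: ler_wpM2l; first exact: powR_ge0.
  have h1 : M^-1 * (\int[mu]_(y in cube x r) `|g y|)%R <= r ^+ N / 2.
    rewrite ler_pdivrMl//; apply: (le_trans Ig).
    rewrite (_ : M * _ = C5 * e * r ^+ N); last by rewrite /M; field.
    by rewrite !ler_wpM2r ?(ltW rN0) ?(ltW e_gt0)// gerBl.
  have h2 : r ^+ N <= (2 * r) ^+ N.
    by rewrite lerXn2r ?nnegrE ?mulr_ge0 ?(ltW r0)//; lra.
  lra.
have Mr : M <= r `^ gam.
  rewrite /M /e mulrA -[leRHS]mul1r ler_wpM2r ?powR_ge0//.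
(* Here r <= 1 and gam a >= m enter: r^-m is at most the power -a of r^gam. *)
have Mra : r `^ (- m) <= M `^ (- a).
  apply: (@le_trans _ _ ((r `^ gam) `^ (- a))).
    rewrite -powRrM; apply: ger_powR; first by rewrite r0.
    by rewrite mulrN lerN2.
  rewrite !powRN lef_pV2 ?posrE ?powR_gt0//.
  by apply: ge0_ler_powR => //; rewrite ?nnegrE ?powR_ge0// ltW.
have rd : r `^ (- m) * r ^+ N = r `^ d.
  rewrite -powR_mulrn ?(ltW r0)// -powRD; last by rewrite (gt_eqF r0) implybT.
  by congr powR; ring.
have rd0 : 0 < r `^ d by exact: powR_gt0.
have : r `^ d / 2 <= eps * r `^ d.
  apply: le_trans low; rewrite -rd -mulrA ler_wpM2r// mulr_ge0 ?invr_ge0//.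
  exact: ltW.
have : eps * r `^ d <= 1 / 4 * r `^ d by rewrite ler_wpM2r// ltW.
lra.
Qed.

(** Poincaré's inequality combined with Young's on each partial derivative, whose b-th power
    integral is at most the energy. *)
Lemma energy_local_poincare : exists2 C, 0 < C & forall (eps r : R) (x : V),
  0 < eps -> 0 < r -> box (x - const_mx r) (x + const_mx r) `<=` Om ->
  (\int[mu]_(y in cube x r) energy y <= (eps * r `^ d)%:E)%E ->
  exists c,
    (\int[mu]_(y in cube x r) `|(g y - c)%R| <= C * (eps `^ b^-1 * r `^ gam) * r ^+ N)%R.
Proof.
have [C C0 HC] := @poincare_cube R n.
exists (C * (N%:R * (2 ^+ N + 1))).
  by rewrite !mulr_gt0 ?ltr0n// ltr_wpDl// exprn_ge0.
move=> eps r x eps0 r0 boxOm HE.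
have QOm : cube x r `<=` Om.
  by apply: subset_trans boxOm => y xy i; have /andP[/ltW -> /ltW ->] := xy i.
have mQ := @measurable_cube R n x r.
have Qfin : (mu (cube x r) < +oo)%E by exact: obox_fin.
have igQ := integrable_power_sub b1 mOm mQ QOm Qfin mg ig.
have ihQ j := integrable_power_sub b1 mOm mQ QOm Qfin (mh j) (ih j).
have [c Hc] := HC Om g h x r mOm mg mh W r0 boxOm igQ ihQ.
exists c; apply: (le_trans Hc).
(* This choice balances Young's two terms: lam^b r^N = eps r^d makes both multiples of lam r^N, and
   r lam = eps^(1/b) r^gam. *)
pose lam := eps `^ b^-1 * r `^ (- (m / b)).
have lam0 : 0 < lam by rewrite mulr_gt0// powR_gt0.
have lamb : lam `^ b = eps * r `^ (- m).
  rewrite powRM ?powR_ge0// -!powRrM mulVf ?gt_eqF// powRr1 ?(ltW eps0)//.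
  by congr (_ * powR _ _); field; rewrite gt_eqF.
have hE j : (\int[mu]_(y in cube x r) (`|h j y| `^ b) <= eps * r `^ d)%R.
  have ihb := integrableS mOm mQ QOm (ih j).
  rewrite -lee_fin /Rintegral fineK; last exact: (integrable_fin_num mQ ihb).
  apply: le_trans HE; apply: le_integral => //; first exact: integrableS iH.
  move=> y _; rewrite /energy (bigD1 j)//= -addeA leeDl// adde_ge0 ?inv_power_ge0//.
  by apply: sume_ge0 => i _; rewrite lee_fin powR_ge0.
have hj j : (\int[mu]_(y in cube x r) `|h j y| <= lam * r ^+ N * (2 ^+ N + 1))%R.
  apply: (le_trans (Rintegral_young b1 mOm mQ QOm Qfin (mh j) (ih j) lam0 (hE j))).
  rewrite lebm_cube ?(ltW r0)//= lamb le_eqVlt; apply/orP; left; apply/eqP.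
  have -> : r `^ d = r ^+ N * r `^ (- m).
    rewrite -powR_mulrn ?(ltW r0)// -powRD; last by rewrite (gt_eqF r0) implybT.
    by congr powR; ring.
  rewrite exprMn; field.
  by rewrite (gt_eqF eps0) gt_eqF// powR_gt0.
have lamr : r * lam = eps `^ b^-1 * r `^ gam.
  rewrite /lam mulrCA; congr (_ * _).
  rewrite -{1}[r]powRr1 ?(ltW r0)// -powRD//.
  by rewrite (gt_eqF r0) implybT.
have S : \sum_(j < n.+1) (\int[mu]_(y in cube x r) `|h j y|)%R <=
    N%:R * (lam * r ^+ N * (2 ^+ N + 1)).
  apply: (le_trans (ler_sum _ (fun j _ => hj j))).
  by rewrite sumr_const card_ord -[leLHS]mulr_natl.
have Cr0 : 0 <= C * r by rewrite mulr_ge0 ?(ltW C0) ?(ltW r0).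
apply: (le_trans (ler_wpM2l Cr0 S)).
rewrite -lamr le_eqVlt; apply/orP; left; apply/eqP; ring.
Qed.

(** If all small cubes at x had little energy, the local Poincaré estimate would hold at every scale
    down to 0, as the telescoping requires. One [eps] serves all zeros, which the covering argument
    needs. *)
Lemma energy_decay_fails : exists2 eps, 0 < eps & forall x rho, zero_set Om g x -> 0 < rho ->
  exists r, [/\ 0 < r, r < rho, cube x r `<=` Om &
    ((eps * r `^ d)%:E < \int[mu]_(y in cube x r) energy y)%E].
Proof.
have [C1 C10 HC] := energy_local_poincare.
(* The factor from [ball_avg_close] times [C1]; the powers of r cancel. *)
pose C2 := (2 * N%:R) ^+ N * C1.
pose B := 2 * (C1 + 2 ^+ N * (C2 + 2 * C2 / (1 - 2 `^ (- gam))) + 1).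
have C20 : 0 <= C2 by rewrite mulr_ge0 ?(ltW C10)// exprn_ge0// mulr_ge0.
have q1 : 2 `^ (- gam) < 1.
  rewrite powRN invf_lt1 ?powR_gt0//.
  have : 1 `^ gam < 2 `^ gam by apply: gt0_ltr_powR; rewrite ?nnegrE// ltr1n.
  by rewrite powR1.
have B0 : 0 < B.
  have q0 : 0 <= 1 - 2 `^ (- gam) by rewrite subr_ge0 ltW.
  have t0 : 0 <= 2 * C2 / (1 - 2 `^ (- gam)) by rewrite divr_ge0// mulr_ge0.
  apply: mulr_gt0 => //; apply: ltr_wpDl => //; apply: addr_ge0; first exact: ltW.
  by apply: mulr_ge0; [exact: exprn_ge0|exact: addr_ge0].
(* The second bound is B eps^(1/b) <= 1 solved for eps. *)
pose eps := Num.min (1/4) (B `^ (- b)).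
have eps0 : 0 < eps by rewrite lt_min powR_gt0// andbT divr_gt0.
have eps4 : eps <= 1/4 by rewrite ge_min lexx.
have epsB : B * eps `^ b^-1 <= 1.
  rewrite -ler_pdivlMl// mulr1.
  apply: (@le_trans _ _ ((B `^ (- b)) `^ b^-1)).
    apply: ge0_ler_powR; rewrite ?nnegrE ?powR_ge0 ?invr_ge0 ?(ltW b0) ?(ltW eps0)//.
    by rewrite ge_min lexx orbT.
  by rewrite -powRrM mulNr mulfV ?gt_eqF// powR_inv1// ltW.
exists eps => // x rho [Omx avg0] rho0.
apply: contrapT => /forallNP H.
have /nbhs_ballP[dl /= dl0 dlOm] := open_nbhs_nbhs (conj oOm Omx).
rewrite (ball_cube x dl0) in dlOm.
(* Halving makes the inequalities strict, so that the closed box of radius [rh] still lies in [Om];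
   [energy_decay_contra] asks for rh <= 1. *)
pose rh := Num.min (Num.min (rho / 2) (dl / 2)) 1.
have rh0 : 0 < rh by rewrite !lt_min ltr01 !divr_gt0.
have rh1 : rh <= 1 by rewrite ge_min lexx orbT.
have rhdl : rh < dl.
  have : rh <= dl / 2 by rewrite /rh !ge_min lexx orbT.
  by move=> h1; apply: (le_lt_trans h1); lra.
have rhrho : rh < rho.
  have : rh <= rho / 2 by rewrite /rh !ge_min lexx.
  by move=> h1; apply: (le_lt_trans h1); lra.
have boxOm r : r <= rh -> box (x - const_mx r) (x + const_mx r) `<=` Om.
  move=> rr; apply: subset_trans dlOm; apply: box_sub_cube.
  exact: le_lt_trans rr rhdl.
have cubeOm r : r <= rh -> cube x r `<=` Om.
  by move=> rr; apply: subset_trans (boxOm r rr) => y xy i; have /andP[/ltW -> /ltW ->] := xy i.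
have HE r : 0 < r <= rh -> (\int[mu]_(y in cube x r) energy y <= (eps * r `^ d)%:E)%E.
  move=> /andP[r0 rrh]; rewrite leNgt; apply/negP => lt.
  apply: (H r); split => //; [exact: le_lt_trans rrh rhrho|exact: cubeOm].
apply: (@energy_decay_contra C1 C2 eps (ltW C10) C20 eps0 eps4 epsB x rh _ _ avg0).
- by rewrite rh0.
- exact: cubeOm.
- move=> r /[dup] rr /andP[r0 rrh].
  have [c Hc] := HC eps r x eps0 r0 (boxOm r rrh) (HE r rr).
  exists c; split => // s sr.
  have mQ := @measurable_cube R n x r.
  have Qfin : (mu (cube x r) < +oo)%E by exact: obox_fin.
  have igQ := integrable_power_sub b1 mOm mQ (cubeOm r rrh) Qfin mg ig.
  apply: (le_trans (ball_avg_close mOm c (cubeOm r rrh) mg igQ r0 sr)).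
  have k0 : 0 <= (2 * N%:R / r) ^+ N by rewrite exprn_ge0// divr_ge0 ?mulr_ge0// ltW.
  apply: (le_trans (ler_wpM2l k0 Hc)).
  rewrite le_eqVlt; apply/orP; left; apply/eqP; rewrite /C2 expr_div_n.
  move: ((2 * N%:R) ^+ N) (eps `^ _ * r `^ _) => k e.
  by field; rewrite expf_eq0 /= gt_eqF.
- by apply: HE; rewrite rh0 lexx.
Qed.

End energy.

(** * Coverings and Hausdorff measure *)

(** Zorn's lemma selects the family for arbitrary sets with bounded radii; no geometry and no
    countability is involved at this stage. *)
Lemma vitali_disjoint_family {R : realType} (X I : Type) (B : I -> set X) (rad : I -> R)
    (F : set I) (rho : R) :
  (forall i, F i -> B i !=set0 /\ 0 < rad i <= rho) ->
  exists D, [/\ D `<=` F, trivIset D B &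
    forall i, F i -> exists2 j, D j & B i `&` B j !=set0 /\ rad i <= 2 * rad j].
Proof.
move=> FB.
pose meets i (D : set I) := exists2 j, D j & B i `&` B j !=set0.
(* Domination is asked only of members of [F] that meet the family. This passes to unions of chains,
   and maximality then forces every member of [F] to meet it. *)
pose P (D : set I) := [/\ D `<=` F, trivIset D B & forall i, F i -> meets i D ->
  exists2 j, D j & B i `&` B j !=set0 /\ rad i <= 2 * rad j].
have [|D [[DF tD DP] Dmax]] := @Zorn_bigcup I P.
  move=> C CP totC; split.
  - by move=> i [D CD Di]; have [DF _ _] := CP _ CD; exact: DF.
  - move=> i j [D1 C1 i1] [D2 C2 j2].
    have [_ t1 _] := CP _ C1; have [_ t2 _] := CP _ C2.
    by have [s|s] := totC _ _ C1 C2; [apply: t2 => //; exact: s|apply: t1 => //; exact: s].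
  - move=> i Fi [j [D CD Dj] ij]; have [_ _ DP] := CP _ CD.
    have [|k Dk ik] := DP i Fi; first by exists j.
    by exists k => //; exists D.
exists D; split => // i Fi; apply: (DP) => //.
apply: contrapT => iD.
pose A := [set i | F i /\ ~ meets i D].
have A0 : [set rad i | i in A] !=set0 by exists (rad i), i.
have Aub : has_sup [set rad i | i in A].
  by split => //; exists rho => _ [j [Fj _] <-]; have [_ /andP[]] := FB _ Fj.
set s := sup [set rad i | i in A].
have s0 : 0 < s.
  have [_ /andP[r0 _]] := FB _ Fi; apply: (lt_le_trans r0).
  by apply: ub_le_sup; [exact: Aub.2|exists i].
have s20 : 0 < s / 2 by rewrite divr_gt0.
(* Among the members of [F] meeting nothing in [D], [k] has radius more than half the supremum;
   adding it preserves [P], against maximality. *)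
have [_ [k [Fk kD] <-] ks] := sup_adherent s20 Aub.
have {}ks : s < 2 * rad k by move: ks; rewrite -/s; lra.
apply: (Dmax (D `|` [set k])).
  split; first by left.
  move=> /(_ k); apply/not_implyP; split; first by right.
  by move=> Dk; apply: kD; exists k => //; rewrite setIid; have [] := FB _ Fk.
split.
- by move=> j [/DF//|->].
- move=> j l [Dj|->] [Dl|->] //.
  + exact: tD.
  + by move=> jk; exfalso; apply: kD; exists j => //; rewrite setIC.
  + by move=> jk; exfalso; apply: kD; exists l.
- move=> j Fj jD'; have [jD|jD] := pselect (meets j D).
    by have [l Dl jl] := DP j Fj jD; exists l => //; left.
  have [l [Dl|->] jl] := jD'; first by exfalso; apply: jD; exists l.
  exists k; first by right.
  split => //; apply: le_trans (ltW ks); apply: ub_le_sup; first exact: Aub.2.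
  by exists j.
Qed.

Section cube_families.
Context {R : realType} {n : nat}.
Local Notation V := 'rV[R]_n.+1.
Local Notation T := (lebT R n).
Local Notation mu := (@lebm R n).
Local Notation N := (n.+1).

Lemma cube_center (p : V) (r : R) : 0 < r -> cube p r p.
Proof. by move=> r0; apply/cubeP => i; rewrite subrr normr0. Qed.

Lemma cube_rational (p : V) (r : R) : 0 < r ->
  exists q : 'rV[rat]_n.+1, cube p r (map_mx ratr q).
Proof.
move=> r0.
have H (i : 'I_n.+1) : exists q : rat, `|ratr q - p ord0 i| < r.
  have pr : p ord0 i - r < p ord0 i + r by lra.
  have [q] := rat_in_itvoo pr; rewrite in_itv/= => /andP[q1 q2]; exists q.
  by rewrite ltr_norml; apply/andP; split; lra.
have [q Hq] := choice H.
by exists (\row_i q i); apply/cubeP => i; rewrite !mxE.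
Qed.

(** Disjoint open cubes contain distinct rational points, whose codes serve as indices. *)
Lemma disjoint_cubes_countable (D : set (V * R)) :
  (forall i, D i -> 0 < i.2) -> trivIset D (fun i => cube i.1 i.2) ->
  exists c : nat -> V * R, [/\ forall k, D (c k) \/ (c k).2 = 0,
    forall i, D i -> exists k, c k = i & trivIset setT (fun k => cube (c k).1 (c k).2)].
Proof.
move=> D0 tD.
have H (i : V * R) : exists q : 'rV[rat]_n.+1, D i -> cube i.1 i.2 (map_mx ratr q).
  have [Di|nDi] := pselect (D i); last by exists 0.
  by have [q Hq] := cube_rational i.1 (D0 _ Di); exists q.
have [q Hq] := choice H.
pose f i := pickle (q i).
have finj i j : D i -> D j -> f i = f j -> i = j.
  move=> Di Dj /(pcan_inj (@pickleK _)) qij; apply: (tD i j Di Dj).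
  by exists (map_mx ratr (q i)); split; [exact: Hq|rewrite qij; exact: Hq].
(* An index without a cube gets radius 0: its cube is empty, and it contributes 0^d = 0 to the sums
   since d > 0. *)
pose c k := xget (0, 0) [set i | D i /\ f i = k].
have cD k : (D (c k) /\ f (c k) = k) \/ c k = (0, 0).
  by rewrite /c; case: xgetP => [i _ [Di fi]|_]; [left|right].
exists c; split.
- by move=> k; have [[Dk _]|->] := cD k; [left|right].
- move=> i Di; exists (f i); rewrite /c; case: xgetP => [j _ [Dj fj]|/(_ i)[]//].
  exact: finj.
- move=> k l _ _ [y [yk yl]].
  have [[Dk fk]|ck] := cD k; last first.
    by move: yk; rewrite ck => /cubeP/(_ ord0); rewrite ltNge normr_ge0.
  have [[Dl fl]|cl] := cD l; last first.
    by move: yl; rewrite cl => /cubeP/(_ ord0); rewrite ltNge normr_ge0.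
  by rewrite -fk -fl; congr f; apply: (tD _ _ Dk Dl); exists y.
Qed.

(** The selected cubes are disjoint and lie in [U], so their energies add up to at most that of [U].
    A centre x lies within r + r_j <= 3 r_j of the selected cube's centre, hence in the fivefold
    enlargement. *)
Lemma cube_cover_energy (Z : set V) (U : set T) (H : T -> \bar R) (d eps rho : R) :
  0 < d -> 0 < eps -> 0 < rho -> measurable U -> measurable_fun U H -> (forall x, (0 <= H x)%E) ->
  (forall x, Z x -> exists r, [/\ 0 < r, r < rho, cube x r `<=` U &
    ((eps * r `^ d)%:E < \int[mu]_(y in cube x r) H y)%E]) ->
  exists c : nat -> V * R, [/\ Z `<=` \bigcup_k cube (c k).1 (5 * (c k).2),
    forall k, 0 <= (c k).2 <= rho &
    (\sum_(k <oo) (eps * (c k).2 `^ d)%:E <= \int[mu]_(y in U) H y)%E].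
Proof.
move=> d0 eps0 rho0 mU mH H0 ZU.
pose F : set (V * R) := [set i | [/\ 0 < i.2, i.2 < rho, cube i.1 i.2 `<=` U &
    ((eps * i.2 `^ d)%:E < \int[mu]_(y in cube i.1 i.2) H y)%E]].
have [|D [DF tD DP]] := @vitali_disjoint_family R V _ (fun i => cube i.1 i.2) snd F rho.
  move=> [p r] [/= r0 rrho _ _]; split; last by rewrite r0 ltW.
  by exists p; exact: cube_center.
have D0 i : D i -> 0 < i.2 by move=> /DF[].
have [c [cD Dc tc]] := disjoint_cubes_countable D0 tD.
exists c; split.
- move=> x Zx; have [r [r0 rrho rU rH]] := ZU x Zx.
  have Fx : F (x, r) by split.
  have [j Dj [[y [/= /cubeP yx /cubeP yj]] rj]] := DP _ Fx.
  have [k ck] := Dc _ Dj; exists k => //; rewrite ck; apply/cubeP => i.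
  have := ler_distD (y ord0 i) (x ord0 i) (j.1 ord0 i).
  have := yx i; have := yj i; rewrite (distrC (y ord0 i) (x ord0 i)) /= in rj *.
  lra.
- move=> k; have [/DF[k0 kr _ _]|->] := cD k; first by rewrite !ltW.
  by rewrite lexx ltW.
have cU k : cube (c k).1 (c k).2 `<=` U.
  have [/DF[]//|ck y /cubeP/(_ ord0)] := cD k.
  by rewrite ck ltNge normr_ge0.
have bU : \bigcup_k cube (c k).1 (c k).2 `<=` U by move=> y [k _] /cU.
have mb : measurable (\bigcup_k cube (c k).1 (c k).2 : set T).
  by apply: bigcupT_measurable => k; exact: measurable_cube.
apply: (@le_trans _ _ (\int[mu]_(y in \bigcup_k cube (c k).1 (c k).2) H y)%E); last first.
  exact: ge0_subset_integral.
rewrite ge0_integral_bigcup//.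
- apply: lee_nneseries => [k _ _|k _].
    by rewrite lee_fin mulr_ge0 ?powR_ge0// ltW.
  have [/DF[_ _ _ lt]|->] := cD k; first exact: ltW.
  by rewrite powR0 ?gt_eqF// mulr0; exact: integral_ge0.
- by move=> k; exact: measurable_cube.
- exact: measurable_funS mH.
Qed.

Lemma diam_cube (p : V) (s : R) : 0 <= s -> 0 <= diam (cube p s) <= n.+1%:R * (2 * s).
Proof.
move=> s0.
have ub x y : cube p s x -> cube p s y -> enorm (x - y) <= n.+1%:R * (2 * s).
  move=> /cubeP xs /cubeP ys; apply: enorm_le => i; rewrite !mxE.
  have := ler_distD (p ord0 i) (x ord0 i) (y ord0 i).
  by have := xs i; have := ys i; rewrite (distrC (p ord0 i)); lra.
move: s0; rewrite le_eqVlt => /predU1P[s0|s0].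
  have -> : diam (cube p s) = 0.
    rewrite /diam (_ : [set enorm (x - y) | x in cube p s & y in cube p s] = set0) ?sup0//.
    apply/seteqP; split => // t [x xs _]; have /cubeP/(_ ord0) := xs.
    by rewrite -s0 ltNge normr_ge0.
  by rewrite -s0 !mulr0 lexx.
have ne : [set enorm (x - y) | x in cube p s & y in cube p s] !=set0.
  by exists (enorm (p - p)), p; [exact: cube_center|exists p => //; exact: cube_center].
apply/andP; split; last first.
  by apply: ge_sup => // _ [x xs [y ys <-]]; exact: ub.
apply: (@le_trans _ _ (enorm (p - p))); first exact: sqrtr_ge0.
apply: ub_le_sup; last by exists p; [exact: cube_center|exists p => //; exact: cube_center].
by exists (n.+1%:R * (2 * s)) => _ [x xs [y ys <-]]; exact: ub.
Qed.

End cube_families.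

(** Absolute continuity is available for real-valued functions, whereas the energy is infinite where
    g vanishes; passing to [fine] changes an integrable function on a null set only. *)
Lemma integral_small {d} {T : measurableType d} {R : realType} (mu : {measure set T -> \bar R})
    (D : set T) (f : T -> \bar R) (eta : R) :
  measurable D -> mu.-integrable D f -> (forall x, 0 <= f x)%E -> 0 < eta ->
  exists2 delta, 0 < delta & forall A, measurable A -> A `<=` D -> (mu A < delta%:E)%E ->
    (\int[mu]_(x in A) f x <= eta%:E)%E.
Proof.
move=> mD fi f0 eta0.
pose u := (fine \o f) \_ D.
have mf : measurable_fun D f by have /integrableP[] := fi.
have mff : measurable_fun D (fine \o f).
  by apply: (measurableT_comp (fine_measurable measurableT)).
have fae A : A `<=` D -> ae_eq mu A f (EFin \o (fine \o f)).
  move=> AD; apply: filterS (integrable_ae mD fi) => x Hx /AD/Hx fx /=.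
  by rewrite fineK.
have int A : measurable A -> A `<=` D ->
    (\int[mu]_(x in A) f x = \int[mu]_(x in A) (`|u x|)%:E)%E.
  move=> mA AD.
  rewrite (@ge0_ae_eq_integral _ _ _ mu A f (EFin \o (fine \o f)))//.
  - apply: eq_integral => x /set_mem/AD xD /=.
    by rewrite /u/= patchE mem_set// ger0_norm// fine_ge0.
  - exact: measurable_funS mf.
  - by apply/measurable_EFinP; exact: measurable_funS mff.
  - by move=> x _; rewrite lee_fin fine_ge0.
  - exact: fae.
have ui : mu.-integrable setT (EFin \o u).
  rewrite /u -restrict_EFin; apply/(integrable_mkcond _ mD).
  apply/integrableP; split; first exact/measurable_EFinP.
  have /integrableP[_] := fi; congr (_ < +oo)%E.
  transitivity (\int[mu]_(x in D) f x)%E.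
    by apply: eq_integral => x _; rewrite gee0_abs.
  by rewrite int//; apply: eq_integral => x /set_mem xD; rewrite /u/= patchE mem_set.
have [delta [delta0 Hd]] := integral_normr_continuous ui eta0.
exists delta => // A mA AD /(Hd A mA) Heta; rewrite int//.
rewrite -[X in (X <= _)%E]fineK ?lee_fin; first exact: ltW.
have iA : mu.-integrable A (EFin \o (fun x => `|u x|)).
  have /integrable_abse := integrableS measurableT mA (@subsetT _ _) ui.
  exact.
exact: integrable_fin_num.
Qed.

(** * From energy covers to vanishing Hausdorff measure *)

Section hausdorff_null.
Context {R : realType} {n : nat}.
Local Notation V := 'rV[R]_n.+1.
Local Notation T := (lebT R n).
Local Notation mu := (@lebm R n).
Local Notation N := (n.+1).

Lemma hausdorff_delta_ge0 (d delta : R) (Z : set V) : (0 <= hausdorff_delta d delta Z)%E.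
Proof.
apply: le_ereal_inf_tmp => _ [C [_ [_ ->]]].
by apply: nneseries_ge0 => k _ _; rewrite lee_fin powR_ge0.
Qed.

(** A cube of radius 5r has side 10r, hence Euclidean diameter at most 10 N r by the crude bound
    [enorm_le]. *)
Lemma hausdorff_delta_cubes (d delta rho : R) (Z : set V) (c : nat -> V * R) :
  0 <= d -> N%:R * (2 * (5 * rho)) <= delta ->
  Z `<=` \bigcup_k cube (c k).1 (5 * (c k).2) -> (forall k, 0 <= (c k).2 <= rho) ->
  (hausdorff_delta d delta Z <= ((N%:R * 10) `^ d)%:E * \sum_(k <oo) ((c k).2 `^ d)%:E)%E.
Proof.
move=> d0 rhod Zc crho.
rewrite -nneseriesZl; [|by move=> k _; rewrite lee_fin powR_ge0].
apply: (@le_trans _ _ (\sum_(k <oo) ((diam (cube (c k).1 (5 * (c k).2))) `^ d)%:E)%E).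
  apply: ereal_inf_lbound; exists (fun k => cube (c k).1 (5 * (c k).2)); split => //; split => //.
  move=> k x y /cubeP xk /cubeP yk; apply: le_trans rhod; apply: enorm_le => i; rewrite !mxE.
  have := ler_distD ((c k).1 ord0 i) (x ord0 i) (y ord0 i).
  have := xk i; have := yk i; rewrite (distrC ((c k).1 ord0 i)).
  by have /andP[_] := crho k; lra.
apply: lee_nneseries => [k _ _|k _]; first by rewrite lee_fin powR_ge0.
have /andP[ck0 _] := crho k.
have /andP[D0 D1] := @diam_cube R n (c k).1 (5 * (c k).2) (mulr_ge0 (ler0n R 5) ck0).
rewrite -EFinM lee_fin -powRM//.
apply: ge0_ler_powR => //; rewrite ?nnegrE//; first by rewrite !mulr_ge0.
by move: D1; rewrite -mulrA [2 * _]mulrA -natrM.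
Qed.

(** Writing r^N = r^(N-d) r^d with r <= rho gains the factor rho^(N-d), which tends to 0 with rho
    because d < N. *)
Lemma leb_cubes_le (d rho : R) (c : nat -> V * R) :
  d < N%:R -> 0 < rho -> (forall k, 0 <= (c k).2 <= rho) ->
  (mu (\bigcup_k cube (c k).1 (5 * (c k).2) : set T) <=
   (10 ^+ N * rho `^ (N%:R - d))%:E * \sum_(k <oo) ((c k).2 `^ d)%:E)%E.
Proof.
move=> dN rho0 crho; apply: (le_trans (leb_sigma_subadditive _)).
rewrite -nneseriesZl; [|by move=> k _; rewrite lee_fin powR_ge0].
apply: lee_nneseries => [k _ _|k _]; first exact: leb_ge0.
have /andP[ck0 ckr] := crho k.
rewrite leb_cube ?mulr_ge0// -EFinM lee_fin.
rewrite (_ : 2 * (5 * (c k).2) = 10 * (c k).2); last by ring.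
rewrite exprMn -mulrA ler_wpM2l ?exprn_ge0//.
move: ck0; rewrite le_eqVlt => /predU1P[<-|ck0].
  by rewrite expr0n/= mulr_ge0// powR_ge0.
apply: (@le_trans _ _ ((c k).2 `^ (N%:R - d) * (c k).2 `^ d)).
  rewrite -powRD; last by apply/implyP => _; rewrite gt_eqF.
  by rewrite subrK powR_mulrn// ltW.
rewrite ler_wpM2r ?powR_ge0//; apply: ge0_ler_powR; rewrite ?nnegrE ?subr_ge0//; exact: ltW.
Qed.

Lemma open_bigcup_cube (p : nat -> V) (r : nat -> R) : open (\bigcup_k cube (p k) (r k)).
Proof.
apply: bigcup_open => k _; have [ck|ck] := ltP 0 (r k).
  by rewrite -ball_cube//; exact: ball_open.
rewrite (_ : cube _ _ = set0); first exact: open0.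
apply/seteqP; split => // x /cubeP/(_ ord0) h; exfalso.
by have := le_lt_trans (normr_ge0 _) h; rewrite ltNge ck.
Qed.

(* The first covering, inside Om, shows that Z has small Lebesgue measure; absolute continuity
   of the integral then lets the second covering, inside a small neighbourhood of Z, conclude. *)
Lemma energy_hausdorff_null (Om Z : set V) (H : V -> \bar R) (d eps : R) :
  measurable (Om : set T) -> mu.-integrable (Om : set T) (H : T -> \bar R) ->
  (forall x, 0 <= H x)%E -> 0 < d -> d < N%:R -> 0 < eps ->
  (forall x (rho : R), Z x -> 0 < rho -> exists r : R, [/\ 0 < r, r < rho, cube x r `<=` Om &
    ((eps * r `^ d)%:E < \int[mu]_(y in cube x r) H y)%E]) ->
  hausdorff d Z = 0%E.
Proof.
move=> mOm iH H0 d0 dN eps0 ZH.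
have mH : measurable_fun (Om : set T) (H : T -> \bar R) by have /integrableP[] := iH.
pose K := (N%:R * 10 : R) `^ d.
have K0 : 0 < K by rewrite powR_gt0// mulr_gt0.
have cover (U : set T) (rho : R) : measurable U -> U `<=` Om -> 0 < rho ->
    (forall x, Z x -> \forall r \near 0^'+, cube x r `<=` U) ->
    exists c : nat -> V * R, [/\ Z `<=` \bigcup_k cube (c k).1 (5 * (c k).2),
      forall k, 0 <= (c k).2 <= rho &
      (\sum_(k <oo) ((c k).2 `^ d)%:E <= (eps^-1)%:E * \int[mu]_(y in U) H y)%E].
  move=> mU UOm rho0 ZU.
  have [|c [c1 c2 c3]] := @cube_cover_energy R n Z U H d eps rho d0 eps0 rho0 mU
      (measurable_funS mOm UOm mH) H0; last first.
    exists c; split => //; rewrite -lee_pdivrMl ?invr_gt0// invrK.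
    rewrite -nneseriesZl; last by move=> k _; rewrite lee_fin powR_ge0.
    by under eq_eseriesr do rewrite -EFinM.
  move=> x Zx; have [s /= s0 sU] := ZU x Zx.
  have [|r [r0 rs rOm rH]] := ZH x (Num.min s rho) Zx; first by rewrite lt_min s0.
  move: rs; rewrite lt_min => /andP[rs rr]; exists r; split => //.
  by apply: sU => //=; rewrite sub0r normrN gtr0_norm.
have ZOm x : Z x -> \forall r \near 0^'+, cube x r `<=` Om.
  move=> Zx; have [r [r0 _ rOm _]] := ZH x 1 Zx ltr01.
  near=> s; apply: subset_trans rOm; apply: sub_cube; near: s.
  exact: nbhs_right_le.
have IOm : (\int[mu]_(y in (Om : set T)) H y)%E \is a fin_num by exact: integrable_fin_num.
pose I := fine (\int[mu]_(y in (Om : set T)) H y)%E.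
have I0 : 0 <= I by rewrite fine_ge0// integral_ge0.
have small (delta eta : R) : 0 < delta -> 0 < eta -> (hausdorff_delta d delta Z <= eta%:E)%E.
  move=> delta0 eta0.
  (* The threshold eps eta / K is what the factors K, from the diameters, and 1/eps, from the
     covering, turn into eta. *)
  have [t t0 Ht] := integral_small mOm iH H0 (divr_gt0 (mulr_gt0 eps0 eta0) K0).
  have [rho [rho0 rhot]] : exists rho : R, 0 < rho /\
      10 ^+ N * rho `^ (N%:R - d) * (eps^-1 * I) < t.
    (* The radius solves rho^(N-d) = t/C; the summand 1 keeps [C] positive and the inequality
       strict. *)
    pose C := 10 ^+ N * (eps^-1 * I) + 1.
    have C0 : 0 < C by rewrite ltr_wpDl// mulr_ge0 ?exprn_ge0// mulr_ge0// invr_ge0 ltW.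
    exists ((t / C) `^ (N%:R - d)^-1).
    have tC : 0 < t / C by rewrite divr_gt0.
    split; first exact: powR_gt0.
    rewrite -powRrM mulVf ?gt_eqF ?subr_gt0// powRr1 ?(ltW tC)//.
    rewrite mulrAC -mulrA mulrA mulrC -mulrA gtr_pMr// mulrC ltr_pdivrMr// mul1r.
    by rewrite /C ltrDl.
  pose rho' := Num.min rho (delta / (N%:R * 10)).
  have K1 : 0 < (N%:R * 10 : R) by rewrite mulr_gt0.
  have rho'0 : 0 < rho' by rewrite lt_min rho0 divr_gt0.
  have [c [Zc crho cs]] := cover Om rho' mOm (@subset_refl _ _) rho'0 ZOm.
  pose U : set V := \bigcup_k cube (c k).1 (5 * (c k).2).
  have mU : measurable (U : set T).
    by apply: bigcupT_measurable => k; exact: measurable_cube.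
  have Ut : (mu (U : set T) < t%:E)%E.
    apply: le_lt_trans (leb_cubes_le dN rho0 _) _.
      by move=> k; have /andP[-> h] := crho k; rewrite (le_trans h)// ge_min lexx.
    apply: le_lt_trans (_ : (_ <= (10 ^+ N * rho `^ (N%:R - d))%:E * ((eps^-1)%:E * I%:E))%E) _.
      apply: lee_wpmul2l; first by rewrite lee_fin mulr_ge0 ?exprn_ge0// powR_ge0.
      by rewrite /I fineK.
    by rewrite -!EFinM lte_fin.
  have oU : open U by exact: (@open_bigcup_cube (fun k => (c k).1) (fun k => 5 * (c k).2)).
  have mUOm : measurable (U `&` Om : set T) by exact: measurableI.
  have [x Zx|c' [Zc' crho' cs']] := cover (U `&` Om) rho' mUOm (@subIsetr _ _ _) rho'0.
    have := oU; rewrite openE => /(_ x (Zc x Zx)) /nbhs_ballP[e /= e0 eU].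
    have := ZOm x Zx; apply: filterS2 (nbhs_right_le e0) => r re rOm.
    rewrite subsetI; split=> //; apply: subset_trans eU; rewrite ball_cube//.
    exact: sub_cube.
  apply: (le_trans (hausdorff_delta_cubes (ltW d0) _ Zc' crho')).
    apply: (@le_trans _ _ (N%:R * 10 * (delta / (N%:R * 10)))); last first.
      by rewrite mulrC divfK// gt_eqF.
    rewrite (_ : _ * _ = N%:R * 10 * rho'); last by ring.
    by rewrite ler_pM2l// ge_min lexx orbT.
  rewrite -lee_pdivlMl//; apply: (le_trans cs'); rewrite -lee_pdivlMl ?invr_gt0// invrK.
  apply: (le_trans (Ht _ mUOm (@subIsetr _ _ _) _)).
    by apply: le_lt_trans Ut; exact: leb_mono (@subIsetl _ _ _).
  by rewrite -!EFinM lee_fin le_eqVlt; apply/orP; left; apply/eqP; ring.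
have null (delta : R) : 0 < delta -> hausdorff_delta d delta Z = 0%E.
  move=> delta0; apply/eqP; rewrite eq_le hausdorff_delta_ge0 andbT.
  by apply/lee_addgt0Pr => e e0; rewrite add0e; exact: small.
rewrite /hausdorff (_ : [set hausdorff_delta d delta Z | delta in _] = [set 0%E]) ?ereal_sup1//.
apply/seteqP; split => [_ [delta /= /null -> <-]//|_ ->].
by exists 1 => /=; [exact: ltr01|exact: null].
Unshelve. all: by end_near.
Qed.

End hausdorff_null.

Section zero_sets.
Context {R : realType} {n : nat}.
Local Notation V := 'rV[R]_n.+1.
Local Notation T := (lebT R n).
Local Notation mu := (@lebm R n).
Local Notation N := (n.+1).

Lemma lint_integrable (Om : set V) (F : V -> \bar R) : measurable (Om : set T) ->
  measurable_fun (Om : set T) (F : T -> \bar R) -> (forall x, 0 <= F x)%E ->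
  (lint Om F < +oo)%E -> mu.-integrable (Om : set T) (F : T -> \bar R).
Proof.
move=> mOm mF F0; rewrite (@lint_integral R n)// => H; apply/integrableP; split => //.
by apply: le_lt_trans H; rewrite le_eqVlt; apply/orP; left; apply/eqP;
  apply: eq_integral => x _; rewrite gee0_abs.
Qed.

Lemma measurable_normr_powR (Om : set V) (f : V -> R) (p : R) :
  measurable_fun (Om : set T) (f : T -> R) ->
  measurable_fun (Om : set T) (fun x : T => (`|f x| `^ p)%:E).
Proof.
move=> mf; apply/measurable_EFinP.
have mn := measurableT_comp (@normr_measurable R setT) mf.
exact: (measurableT_comp (measurable_powR p) mn).
Qed.

Lemma Lp_integrable (Om : set V) (f : V -> R) (p : R) : Lp p Om f ->
  mu.-integrable (Om : set T) (fun x : T => (`|f x| `^ p)%:E).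
Proof.
case=> /(@leb_measurable_fun_measurable R n)[mOm mf] fp.
apply: lint_integrable fp => //; exact: measurable_normr_powR.
Qed.

Lemma measurable_inv_power (Om : set V) (g : V -> R) (a : R) : measurable (Om : set T) ->
  measurable_fun (Om : set T) (g : T -> R) ->
  measurable_fun (Om : set T) (inv_power g a : T -> \bar R).
Proof.
move=> mOm mg; rewrite /inv_power; apply: measurable_fun_if => //.
  exact: measurable_fun_eqr.
by apply: measurable_funS (measurable_normr_powR (- a) mg).
Qed.

Lemma hausdorff_zero_set (Om : set V) (d b a : R) (g : V -> R) :
  open Om -> 0 < d -> d < N%:R -> 1 <= b -> 0 < a ->
  (1 - (N%:R - d) / b) * a >= N%:R - d -> W1p b Om g ->
  (lint Om (inv_power g a) < +oo)%E ->
  hausdorff d (zero_set Om g) = 0%E.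
Proof.
move=> oOm d0 dN b1 a0 abd [gLp [h hW]] gF.
have [mOm mg] := leb_measurable_fun_measurable gLp.1.
have mh j : measurable_fun (Om : set T) (h j : T -> R).
  by have [[/(@leb_measurable_fun_measurable R n)[]]] := hW j.
have W j : weak_partial Om j g (h j) by have [] := hW j.
have ig := Lp_integrable gLp.
have ih j : mu.-integrable (Om : set T) (fun y : T => (`|h j y| `^ b)%:E).
  by have [/Lp_integrable] := hW j.
have iF : mu.-integrable (Om : set T) (inv_power g a : T -> \bar R).
  apply: lint_integrable gF => //; first exact: measurable_inv_power.
  exact: inv_power_ge0.
have iH : mu.-integrable (Om : set T) (energy g h a b : T -> \bar R).
  apply: integrableD => //; apply: integrable_sum => // j _; exact: ih.
have [eps eps0 Heps] := energy_decay_fails oOm mOm mg mh W ig ih iH iF b1 a0 dN abd.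
exact: (energy_hausdorff_null mOm iH (energy_ge0 _ _ _ _) d0 dN eps0 Heps).
Qed.

End zero_sets.

Theorem mainTheorem7 (R : realType) (n : nat) (Om : set 'rV[R]_n)
    (d b a : R) (g : 'rV[R]_n -> R) :
  open Om ->
  0 < d -> d < n%:R ->
  1 <= b -> 0 < a ->
  (1 - (n%:R - d) / b) * a >= n%:R - d ->
  W1p b Om g ->
  (lint Om (fun x => if (g x == 0)%R then +oo else (`|g x| `^ (- a))%:E) < +oo)%E ->
  hausdorff d (zero_set Om g) = 0%E.
Proof.
(* Dimension zero is excluded by 0 < d < n, so the results for [n.+1] apply. *)
case: n Om g => [|n] Om g oOm d0 dN; first by have := lt_trans d0 dN; rewrite ltxx.
exact: hausdorff_zero_set.
Qed.
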